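(* Let $H$ be a time-independent, hermitian, number-parity-preserving Hamiltonian on $h$, and define the fermionic quantum action operator on $\mathcal H$ by $$e^{i\mathcal S}:=e^{i\epsilon\mathcal P}\prod_{t=0}^{N-1}e^{-i\epsilon H_t}.$$ Let $O^{(1)},\dots,O^{(k)}$ be arbitrary operators on $h$ and $t_1,\dots,t_k\in\{0,\dots,N-1\}$, where repetitions are allowed. Then $$\mathrm{Tr}\Big[P\,e^{i\mathcal S}\,O^{(1)}_{t_1}O^{(2)}_{t_2}\cdots O^{(k)}_{t_k}\Big]=\mathrm{tr}\Big[e^{-iTH}\,\hat T\big[O^{(1)}(\epsilon t_1)\cdots O^{(k)}(\epsilon t_k)\big]\Big],$$ where $O(s):=e^{isH}Oe^{-isH}$ denotes the Heisenberg-picture operator.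
   Context: Fix integers $L\ge1$, $N\ge1$, a real $\epsilon>0$, and set $T=\epsilon N$. The space $h$ and its trace. Let $h$ be the fermionic Fock space of $L$ modes, so $\dim h=2^L$. It is generated from a vacuum $|0\rangle$ by operators $a_i$, $i=1,\dots,L$, with $a_i|0\rangle=0$, $\{a_i,a_j^\dagger\}=\delta_{ij}$ and $\{a_i,a_j\}=\{a_i^\dagger,a_j^\dagger\}=0$. The symbol $\mathrm{tr}$ denotes the trace on $h$. The space $\mathcal H$ and its trace. Let $\mathcal H$ be the Fock space of $LN$ modes, so $\dim\mathcal H=2^{LN}$. It is generated from a vacuum $|\Omega\rangle$ by operators $a_{ti}$, $t=0,\dots,N-1$, $i=1,\dots,L$, with $a_{ti}|\Omega\rangle=0$, $\{a_{ti},a^\dagger_{t'j}\}=\delta_{tt'}\delta_{ij}$ and $\{a_{ti},a_{t'j}\}=\{a^\dagger_{ti},a^\dagger_{t'j}\}=0$. In particular, ladder operators with different time labels $t$ anticommute. The symbol $\mathrm{Tr}$ denotes the trace on $\mathcal H$. Time translations and parity. Set $\omega_n=(2n+1)\pi/T$ and $\hat a_{ni}:=N^{-1/2}\sum_{t=0}^{N-1}e^{i\omega_n\epsilon t}a_{ti}$ for $n=0,\dots,N-1$. Define $$\mathcal P:=\sum_{n=0}^{N-1}\sum_{j}\omega_n\hat a^\dagger_{nj}\hat a_{nj},\qquad P:=\exp\Big(i\pi\sum_{t,i}a^\dagger_{ti}a_{ti}\Big).$$ Placing operators on a slice. For an operator $O$ on $h$ and a slice $t$, $O_t$ denotes the image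 of $O$ under the unital $*$-homomorphism from operators on $h$ to operators on $\mathcal H$ determined by $a_i\mapsto a_{ti}$. Equivalently, one writes $O$ as a polynomial in $a_i,a_j^\dagger$ and substitutes $a_i\to a_{ti}$, $a_j^\dagger\to a_{tj}^\dagger$. Parity-preserving Hamiltonians. An operator on $h$ is even (resp. odd) if it commutes (resp. anticommutes) with $e^{i\pi\sum_i a_i^\dagger a_i}$. A Hamiltonian $H$ is parity preserving if it is even, i.e. a polynomial in the ladder operators each monomial of which has an even number of factors. We write $H_t$ for $H$ placed on slice $t$. Fermionic time ordering $\hat T$. Let $B_1,\dots,B_k$ be operators on $h$ of definite parity, with real time labels $s_1,\dots,s_k$. Let $\sigma$ be the unique permutation such that $s_{\sigma(1)}\ge s_{\sigma(2)}\ge\dots\ge s_{\sigma(k)}$ and such that entries with equal labels keep their original relative order. Define $$\hat T[B_1\cdots B_k]:=(-1)^\gamma B_{\sigma(1)}\cdots B_{\sigma(k)},$$ where $\gamma$ is the number of pairs of odd operators whose relative order is reversed by $\sigma$. Later times thus appear to the left. $\hat T$ is extended multilinearly to arbitrary operators by splitting each into its even and odd parts. In the present statement the label of $O^{(l)}(\epsilon t_l)$ is $\epsilon t_l$. *)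

(* Defs.v *)
From HB Require Import structures.
From mathcomp Require Import all_boot all_order all_algebra.
From mathcomp Require Import all_classical all_reals all_analysis.
From mathcomp Require Import complex.
From Stdlib Require Import ClassicalEpsilon.
Set Implicit Arguments.
Unset Strict Implicit.
Unset Printing Implicit Defensive.
Import Order.TTheory GRing.Theory Num.Theory.
Import numFieldNormedType.Exports.
Local Open Scope ring_scope.
Local Open Scope complex_scope.

Section FermionDefs.
Variable R : realType.
Local Notation C := R[i].

Definition cexp (z : C) : C :=
  limn (fun m : nat => (\sum_(k < m) (k`!%:R)^-1 * z ^+ k : C^o)).

Definition expm (n : nat) (A : 'M[C]_n) : 'M[C]_n :=
  limn (fun m : nat => \sum_(k < m) (k`!%:R)^-1 *: A ^+ k).

Definition adjmx (n : nat) (A : 'M[C]_n) : 'M[C]_n := (map_mx conjc A)^T.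

(* The Fock space of M modes is C^(2^M), with orthonormal basis |x>,
   x < 2^M, where bit m of x is the occupation number of mode m.
   The vacuum is |0>.  Annihilation operators are given by the
   Jordan--Wigner construction:
     a_m |x> = (-1)^(sum_{j<m} n_j(x)) |x - 2^m>  if n_m(x) = 1, else 0. *)
Definition occ (x m : nat) : bool := odd (x %/ 2 ^ m).

Definition ann (M m : nat) : 'M[C]_(2 ^ M) :=
  \matrix_(x < 2 ^ M, y < 2 ^ M)
    (if occ y m && (x == (y - 2 ^ m)%N :> nat)
     then (-1) ^+ (\sum_(j < m) occ y j)%N else 0).

Definition numop (M : nat) : 'M[C]_(2 ^ M) :=
  \sum_(m < M) adjmx (ann M m) *m ann M m.

Definition parity (M : nat) : 'M[C]_(2 ^ M) :=
  expm (('i * (pi : R)%:C) *: numop M).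

Definition gen_h (L : nat) (l : 'I_L * bool) : 'M[C]_(2 ^ L) :=
  if l.2 then adjmx (ann L l.1) else ann L l.1.

Definition aH (L N : nat) (t i : nat) : 'M[C]_(2 ^ (L * N)) :=
  ann (L * N) (t * L + i).

Definition gen_H (L N : nat) (t : nat) (l : 'I_L * bool) : 'M[C]_(2 ^ (L * N)) :=
  if l.2 then adjmx (aH L N t l.1) else aH L N t l.1.

Definition ncpoly (L : nat) := seq (C * seq ('I_L * bool)).

Definition eval_h (L : nat) (p : ncpoly L) : 'M[C]_(2 ^ L) :=
  \sum_(mo <- p) mo.1 *: \prod_(l <- mo.2) gen_h l.

Definition eval_H (L N t : nat) (p : ncpoly L) : 'M[C]_(2 ^ (L * N)) :=
  \sum_(mo <- p) mo.1 *: \prod_(l <- mo.2) gen_H N t l.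

(* O_t : write O as a polynomial in a_i, a_j^dagger and substitute
   a_i -> a_{ti}, a_j^dagger -> a_{tj}^dagger (the unital *-homomorphism
   determined by a_i |-> a_{ti}). *)
Definition slice (L N t : nat) (O : 'M[C]_(2 ^ L)) : 'M[C]_(2 ^ (L * N)) :=
  eval_H N t (epsilon (inhabits [::]) (fun p : ncpoly L => eval_h p = O)).

Definition omega (N : nat) (eps : R) (n : nat) : R :=
  (2 * n%:R + 1) * pi / (eps * N%:R).

Definition ahat (L N : nat) (eps : R) (n j : nat) : 'M[C]_(2 ^ (L * N)) :=
  ((Num.sqrt (N%:R : R))^-1)%:C *:
    \sum_(t < N) cexp ('i * (omega N eps n * eps * t%:R)%:C) *: aH L N t j.

Definition calP (L N : nat) (eps : R) : 'M[C]_(2 ^ (L * N)) :=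
  \sum_(n < N) \sum_(j < L)
     (omega N eps n)%:C *: (adjmx (ahat L N eps n j) *m ahat L N eps n j).

Definition eiS (L N : nat) (eps : R) (H : 'M[C]_(2 ^ L)) : 'M[C]_(2 ^ (L * N)) :=
  expm (('i * eps%:C) *: calP L N eps) *m
  \prod_(t < N) expm ((- ('i * eps%:C)) *: slice N t H).

Definition is_hermitian (n : nat) (A : 'M[C]_n) : Prop := adjmx A = A.

Definition parity_preserving (L : nat) (A : 'M[C]_(2 ^ L)) : Prop :=
  A *m parity L = parity L *m A.

Definition heis (n : nat) (H : 'M[C]_n) (s : R) (O : 'M[C]_n) : 'M[C]_n :=
  expm (('i * s%:C) *: H) *m O *m expm ((- ('i * s%:C)) *: H).

Definition even_part (L : nat) (O : 'M[C]_(2 ^ L)) : 'M[C]_(2 ^ L) :=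
  2^-1 *: (O + parity L *m O *m invmx (parity L)).
Definition odd_part (L : nat) (O : 'M[C]_(2 ^ L)) : 'M[C]_(2 ^ L) :=
  2^-1 *: (O - parity L *m O *m invmx (parity L)).
Definition par_part (L : nat) (isodd : bool) (O : 'M[C]_(2 ^ L)) :=
  if isodd then odd_part O else even_part O.

Definition tsort (k : nat) (s : 'I_k -> R) : seq 'I_k :=
  sort (fun i j : 'I_k => s j <= s i) (enum 'I_k).

(* time ordering of operators B_1..B_k of definite parities par l
   (par l = true means odd), labels s l *)
Definition Tdef (n k : nat) (s : 'I_k -> R) (B : 'I_k -> 'M[C]_n)
    (par : 'I_k -> bool) : 'M[C]_n :=
  let sigma := tsort s in
  let gamma := #|[set p : 'I_k * 'I_k |
                   [&& (p.1 < p.2)%N, par p.1, par p.2 &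
                       (index p.2 sigma < index p.1 sigma)%N]]| in
  (-1) ^+ gamma *: \prod_(l <- sigma) B l.

(* multilinear extension: split every factor into even and odd parts *)
Definition Tord (L k : nat) (s : 'I_k -> R) (B : 'I_k -> 'M[C]_(2 ^ L)) :
    'M[C]_(2 ^ L) :=
  \sum_(c : {ffun 'I_k -> bool}) Tdef s (fun l => par_part (c l) (B l)) c.

End FermionDefs.

(* Main.v *)
(* The Fourier modes diagonalize the translation generator, so U = e^{i eps calP}
   carries slice t to slice t + 1 and the last slice to the first one with an
   extra conjugation by the parity P.  Put V = e^{-i eps H}, W = prod_t V_t and
   E = U W.  Moving an operator A_{t+1} cyclically once around the trace turns
   Tr[P E A_{t+1} Y] into Tr[P E (V^-1 A V)_t Y] when Y lives on the other
   slices: for odd A the sign picked up from Y is exactly undone by P.  A word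
   sorted by decreasing time therefore collapses onto slice 0 with Heisenberg
   operators, and the same move with U alone turns W into V^N on slice 0.  What
   remains, A |-> Tr[P U A_0], is tracial, hence a multiple of tr; the multiple
   is 1 because the product of the slice vacuum projectors is the projector on
   |Omega>, which P and U fix.  Sorting a general word costs the fermionic sign,
   since odd operators on different slices anticommute. *)
Require Import Defs.
From HB Require Import structures.
From mathcomp Require Import all_boot all_order all_algebra.
From mathcomp Require Import all_classical all_reals all_analysis.
From mathcomp Require Import complex.
From mathcomp Require Import ring lra zify.
From Stdlib Require Import ClassicalEpsilon.
Import Order.TTheory GRing.Theory Num.Theory.
Import numFieldNormedType.Exports.
Local Open Scope ring_scope.
Local Open Scope complex_scope.
Set Implicit Arguments.
Unset Strict Implicit.
Unset Printing Implicit Defensive.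

(** Two definitions give no direct hold. [slice] evaluates a polynomial obtained by choice, so
    nothing is known about it until the result is shown not to depend on that polynomial: the
    isometries [block_embed] intertwine [slice N t A] with [A], and their ranges together span the
    large space. [expm] is a bare limit; [expm_intertwine] carries [A B = B A'] over to the
    exponentials, and this yields eigenvectors, scalar shifts, parity invariance and exponentials of
    slices without diagonalizing anything. The parity twist at the last slice comes from the
    half-integer frequencies, for which [omega_n * T] is an odd multiple of pi. It is also what
    makes A |-> Tr[P U A_0] tracial: an operator taken once around the circle is graded once by [P]
    and once by the boundary, and the two cancel. To normalize this trace an even idempotent is
    wanted, since it can be spread from slice 0 to all slices unchanged; the vacuum projector
    becomes rank one there. *)

(** * A submultiplicative norm and the matrix exponential *)

Section MatrixExponential.
Local Open Scope classical_set_scope.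
Variable R : realType.
Local Notation C := R[i].
Local Notation nc := ComplexField.Normc.normc.

(** Real-valued, so that squeezing and comparison with [expR] take place in [R]. It is
    submultiplicative but does not send the identity to 1, hence the factors [nrm 1] below. *)
Definition mxnorm1 m n (A : 'M[C]_(m, n)) : R := \sum_i \sum_j nc (A i j).
Local Notation nrm := mxnorm1.

Lemma normc_ge0 (x : C) : 0 <= nc x.
Proof. by case: x => a b /=; exact: sqrtr_ge0. Qed.

Lemma normc_leD (x y : C) : nc (x + y) <= nc x + nc y.
Proof. exact: le_normcD. Qed.

Lemma normC_normc (x : C) : `|x| = (nc x)%:C.
Proof. by rewrite normc_def; case: x. Qed.

Lemma normc_le_Re_Im (x : C) : nc x <= `|complex.Re x| + `|complex.Im x|.
Proof.
case: x => a b /=; rewrite -(ler_pXn2r (n := 2)) // ?nnegrE ?sqrtr_ge0 ?addr_ge0 //.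
rewrite sqr_sqrtr ?addr_ge0 ?sqr_ge0 // sqrrD !real_normK ?num_real //.
by rewrite lerD2r lerDl mulrn_wge0 // mulr_ge0.
Qed.

Lemma Re_le_normc (x : C) : `|complex.Re x| <= nc x.
Proof.
by case: x => a b /=; rewrite -sqrtr_sqr ler_wsqrtr // lerDl sqr_ge0.
Qed.

Lemma Im_le_normc (x : C) : `|complex.Im x| <= nc x.
Proof.
by case: x => a b /=; rewrite -sqrtr_sqr ler_wsqrtr // lerDr sqr_ge0.
Qed.

Lemma normc_sum (I : Type) (r : seq I) (P : pred I) (F : I -> C) :
  nc (\sum_(i <- r | P i) F i) <= \sum_(i <- r | P i) nc (F i).
Proof.
elim/big_rec2 : _ => [|i y x _ H]; first by rewrite ComplexField.Normc.normc0.
by apply: le_trans (normc_leD _ _) _; rewrite lerD2l.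
Qed.

Lemma mxnorm1_ge0 m n (A : 'M[C]_(m, n)) : 0 <= nrm A.
Proof. by apply: sumr_ge0 => i _; apply: sumr_ge0 => j _; exact: normc_ge0. Qed.

Lemma normc_le_mxnorm1 m n (A : 'M[C]_(m, n)) i j : nc (A i j) <= nrm A.
Proof.
rewrite /nrm (bigD1 i) //= (bigD1 j) //= -addrA lerDl addr_ge0 //.
  by apply: sumr_ge0 => k _; exact: normc_ge0.
by apply: sumr_ge0 => k _; apply: sumr_ge0 => l _; exact: normc_ge0.
Qed.

Lemma mxnorm1D m n (A B : 'M[C]_(m, n)) : nrm (A + B) <= nrm A + nrm B.
Proof.
rewrite /nrm -big_split /=; apply: ler_sum => i _.
by rewrite -big_split /=; apply: ler_sum => j _; rewrite mxE normc_leD.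
Qed.

Lemma mxnorm10 m n : nrm (0 : 'M[C]_(m, n)) = 0.
Proof.
by rewrite /nrm big1 // => i _; rewrite big1 // => j _;
   rewrite mxE ComplexField.Normc.normc0.
Qed.

Lemma mxnorm1Z m n c (A : 'M[C]_(m, n)) : nrm (c *: A) = nc c * nrm A.
Proof.
rewrite /nrm mulr_sumr; apply: eq_bigr => i _; rewrite mulr_sumr.
by apply: eq_bigr => j _; rewrite mxE ComplexField.Normc.normcM.
Qed.

Lemma mxnorm1_sum m n (I : Type) (r : seq I) (P : pred I) (F : I -> 'M[C]_(m, n)) :
  nrm (\sum_(i <- r | P i) F i) <= \sum_(i <- r | P i) nrm (F i).
Proof.
elim/big_rec2 : _ => [|i y x _ H]; first by rewrite mxnorm10.
by apply: le_trans (mxnorm1D _ _) _; rewrite lerD2l.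
Qed.

Lemma mxnorm1M m n p (A : 'M[C]_(m, n)) (B : 'M[C]_(n, p)) :
  nrm (A *m B) <= nrm A * nrm B.
Proof.
rewrite /(nrm A) mulr_suml; apply: ler_sum => i _.
apply: (@le_trans _ _ (\sum_k \sum_j nc (A i j) * nc (B j k))).
  apply: ler_sum => k _; rewrite mxE; apply: le_trans (normc_sum _ _ _) _.
  by apply: ler_sum => j _; rewrite ComplexField.Normc.normcM.
rewrite exchange_big /= mulr_suml; apply: ler_sum => j _.
rewrite -mulr_sumr; apply: ler_wpM2l; first exact: normc_ge0.
rewrite /nrm (bigD1 j) //= lerDl; apply: sumr_ge0 => l _.
by apply: sumr_ge0 => q _; exact: normc_ge0.
Qed.

Lemma mxnorm1X n (A : 'M[C]_n) k : nrm (A ^+ k) <= nrm A ^+ k * nrm (1 : 'M[C]_n).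
Proof.
elim: k => [|k IH]; first by rewrite !expr0 mul1r.
rewrite !exprS; apply: le_trans (mxnorm1M _ _) _.
by rewrite -mulrA ler_wpM2l // mxnorm1_ge0.
Qed.

Lemma mxnorm1_eq0 m n (A : 'M[C]_(m, n)) : nrm A = 0 -> A = 0.
Proof.
move=> A0; apply/matrixP => i j; rewrite mxE; apply: ComplexField.Normc.eq0_normc.
by apply/eqP; rewrite eq_le normc_ge0 andbT -A0 normc_le_mxnorm1.
Qed.

(** Convergence read off one real sequence; [mcvg_lim] leads back to the limit that defines
    [expm]. *)
Definition mcvg m n (u : nat -> 'M[C]_(m, n)) (l : 'M[C]_(m, n)) :=
  nrm (u k - l) @[k --> \oo] --> (0 : R).

Lemma squeeze0 (u v : nat -> R) : (forall k, 0 <= u k <= v k) ->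
  v k @[k --> \oo] --> (0 : R) -> u k @[k --> \oo] --> (0 : R).
Proof.
move=> uv v0; apply: (squeeze_cvgr (f := fun=> 0) (h := v)) => //.
  by near=> k; exact: uv.
exact: cvg_cst.
Unshelve. all: by end_near. Qed.

Lemma mcvg_unique m n (u : nat -> 'M[C]_(m, n)) l l' :
  mcvg u l -> mcvg u l' -> l = l'.
Proof.
move=> ul ul'; apply/eqP; rewrite -subr_eq0; apply/eqP/mxnorm1_eq0.
have H : (fun k => nrm (u k - l) + nrm (u k - l')) @ \oo --> (0 : R).
  by rewrite -[X in _ --> X]addr0; apply: cvgD.
have H2 : nrm (l - l') @[k --> \oo] --> (0 : R).
  apply: squeeze0 H => k; rewrite mxnorm1_ge0 /=.
  have -> : l - l' = (-1) *: (u k - l) + (u k - l').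
    by rewrite scaleN1r opprB addrA subrK.
  apply: le_trans (mxnorm1D _ _) _; rewrite mxnorm1Z.
  by rewrite lerD2r /= oppr0 expr0n /= addr0 sqrrN expr1n sqrtr1 mul1r.
apply/esym; apply: (cvg_unique _ H2); first exact: norm_hausdorff.
exact: cvg_cst.
Qed.

Lemma cvg_complexP (u : nat -> C) (l : C) :
  nc (u k - l) @[k --> \oo] --> (0 : R) -> (u : nat -> C^o) k @[k --> \oo] --> (l : C^o).
Proof.
move=> H; apply/cvgrPdist_lt => e e0.
have eE : e = (complex.Re e)%:C by move: e0; rewrite ltcE; case: e => a b /= /andP[/eqP -> _].
have e0' : 0 < complex.Re e by rewrite -ltcR -eE.
move/cvgr0Pnorm_lt : H => /(_ _ e0'); apply: filterS => k.
rewrite ger0_norm ?normc_ge0 // distrC => h.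
by rewrite normC_normc eE ltcR.
Qed.

Lemma mcvg_cvg m n (u : nat -> 'M[C]_(m, n)) l : mcvg u l ->
  (u : nat -> ('M[C]_(m, n) : normedModType C)) k @[k --> \oo]
    --> (l : ('M[C]_(m, n) : normedModType C)).
Proof.
move=> H; apply/cvg_ballP => e e0.
have eE : e = (complex.Re e)%:C by move: e0; rewrite ltcE; case: e => a b /= /andP[/eqP -> _].
have e0' : 0 < complex.Re e by rewrite -ltcR -eE.
move/cvgr0Pnorm_lt : H => /(_ _ e0'); apply: filterS => k.
rewrite ger0_norm ?mxnorm1_ge0 // => h; split=> // i j.
rewrite -ball_normE /ball_ /= distrC normC_normc eE ltcR; apply: le_lt_trans h.
have -> : u k i j - l i j = (u k - l) i j by rewrite !mxE.
exact: normc_le_mxnorm1.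
Qed.

Lemma mcvg_lim m n (u : nat -> 'M[C]_(m, n)) l : mcvg u l ->
  limn (u : nat -> ('M[C]_(m, n) : normedModType C)) = l.
Proof. by move=> /mcvg_cvg; apply: cvg_lim; exact: norm_hausdorff. Qed.

Lemma cvg_sum0 (I : Type) (r : seq I) (u : I -> nat -> R) :
  (forall i, u i k @[k --> \oo] --> (0 : R)) ->
  (\sum_(i <- r) u i k) @[k --> \oo] --> (0 : R).
Proof.
move=> ul; elim: r => [|i r IH].
  rewrite (_ : (fun _ => _) = fun=> 0); first exact: cvg_cst.
  by apply/funext => k; rewrite big_nil.
rewrite (_ : (fun _ => _) = fun k => u i k + \sum_(j <- r) u j k).
  by rewrite -[X in _ --> X]addr0; apply: cvgD.
by apply/funext => k; rewrite big_cons.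
Qed.

Lemma mcvg_entries m n (u : nat -> 'M[C]_(m, n)) (a b : 'I_m -> 'I_n -> R) :
  (forall i j, complex.Re (u k i j) @[k --> \oo] --> a i j) ->
  (forall i j, complex.Im (u k i j) @[k --> \oo] --> b i j) ->
  mcvg u (\matrix_(i, j) (a i j +i* b i j)).
Proof.
move=> Ha Hb; rewrite /mcvg.
apply: (@squeeze0 _ (fun k => \sum_i \sum_j
   (`|complex.Re (u k i j) - a i j| + `|complex.Im (u k i j) - b i j|))).
  move=> k; rewrite mxnorm1_ge0 /=; apply: ler_sum => i _; apply: ler_sum => j _.
  rewrite !mxE; apply: le_trans (normc_le_Re_Im _) _.
  by case: (u k i j) => x y /=.
pose v i j (k : nat) := `|complex.Re (u k i j) - a i j| + `|complex.Im (u k i j) - b i j|.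
apply: (@cvg_sum0 _ _ (fun i k => \sum_j v i j k)) => i.
apply: (@cvg_sum0 _ _ (v i)) => j.
rewrite /v -[X in _ --> X]addr0; apply: cvgD.
- rewrite -(normr0 R) -(subrr (a i j)); apply: cvg_norm; apply: cvgB; first exact: Ha.
  exact: cvg_cst.
- rewrite -(normr0 R) -(subrr (b i j)); apply: cvg_norm; apply: cvgB; first exact: Hb.
  exact: cvg_cst.
Qed.

Lemma mcvgMl m n p (B : 'M[C]_(m, n)) (u : nat -> 'M[C]_(n, p)) l :
  mcvg u l -> mcvg (fun k => B *m u k) (B *m l).
Proof.
move=> H; apply: (@squeeze0 _ (fun k => nrm B * nrm (u k - l))) => [k|].
  by rewrite mxnorm1_ge0 /= -mulmxBr mxnorm1M.
by rewrite -(mulr0 (nrm B)); apply: cvgMr.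
Qed.

Lemma mcvgMr m n p (B : 'M[C]_(n, p)) (u : nat -> 'M[C]_(m, n)) l :
  mcvg u l -> mcvg (fun k => u k *m B) (l *m B).
Proof.
move=> H; apply: (@squeeze0 _ (fun k => nrm (u k - l) * nrm B)) => [k|].
  by rewrite mxnorm1_ge0 /= -mulmxBl mxnorm1M.
by rewrite -(mul0r (nrm B)); apply: cvgMl.
Qed.

Definition expsum n (A : 'M[C]_n) (m : nat) : 'M[C]_n :=
  \sum_(k < m) (k`!%:R)^-1 *: A ^+ k.

Lemma normc_nat k : nc (k%:R : C) = k%:R.
Proof. by apply: complexI; rewrite -normC_normc normr_nat rmorph_nat. Qed.

Lemma mxnorm1_expterm n (A : 'M[C]_n) k :
  nrm ((k`!%:R)^-1 *: A ^+ k) <= exp_coeff (nrm A) k * nrm (1 : 'M[C]_n).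
Proof.
rewrite mxnorm1Z ComplexField.Normc.normcV normc_nat /exp_coeff /= mulrAC.
by rewrite mulrC ler_wpM2r ?invr_ge0 ?ler0n // mxnorm1X.
Qed.

(** An abstract [f] serves for real and imaginary parts alike. The series is dominated termwise by
    the real exponential series at [nrm A]. *)
Lemma expsum_series n (A : 'M[C]_n) (f : C -> R) :
  {morph f : x y / x + y} -> f 0 = 0 -> (forall x, `|f x| <= nc x) ->
  forall i j, cvgn (fun k => f (expsum A k i j)).
Proof.
move=> fD f0 fle i j; pose a := fun k => f (((k`!%:R)^-1 *: A ^+ k) i j).
have -> : (fun k => f (expsum A k i j)) = series a.
  apply/funext => k; rewrite /expsum summxE (big_morph f fD f0).
  by rewrite /series /= big_mkord.
apply: normed_cvg.
apply: (@series_le_cvg _ _ (fun k => nrm (1 : 'M[C]_n) *: exp_coeff (nrm A) k)).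
- by move=> k /=.
- by move=> k; rewrite mulr_ge0 ?mxnorm1_ge0 // exp_coeff_ge0 // mxnorm1_ge0.
- move=> k; rewrite /a /=; apply: le_trans (fle _) _.
  apply: le_trans (normc_le_mxnorm1 _ _ _) _; rewrite /GRing.scale /= mulrC.
  exact: mxnorm1_expterm.
- exact: is_cvg_seriesZ (is_cvg_series_exp_coeff _).
Qed.

Lemma mcvg_expsum n (A : 'M[C]_n) : mcvg (expsum A) (expm A).
Proof.
have Hre : forall i j, cvgn (fun k => complex.Re (expsum A k i j)).
  apply: expsum_series => //; last exact: Re_le_normc.
  by case=> [? ?] [].
have Him : forall i j, cvgn (fun k => complex.Im (expsum A k i j)).
  apply: expsum_series => //; last exact: Im_le_normc.
  by case=> [? ?] [].
have ul := mcvg_entries Hre Him.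
by rewrite /expm (mcvg_lim ul).
Qed.

Lemma expm_unique n (A l : 'M[C]_n) : mcvg (expsum A) l -> expm A = l.
Proof. exact: mcvg_unique (mcvg_expsum A). Qed.

Lemma expsum_intertwine m n (A : 'M[C]_m) (A' : 'M[C]_n) B k :
  A *m B = B *m A' -> expsum A k *m B = B *m expsum A' k.
Proof.
move=> AB; rewrite /expsum mulmx_suml mulmx_sumr; apply: eq_bigr => q _.
rewrite -scalemxAl -scalemxAr; congr (_ *: _).
elim: (nat_of_ord q) => [|r IH]; first by rewrite !expr0 -[1]/(1%:M) mul1mx -[1]/(1%:M) mulmx1.
rewrite !exprS -[A * _]/(A *m _) -[A' * _]/(A' *m _).
by rewrite -mulmxA IH !mulmxA AB.
Qed.

(** [B] may be rectangular: a column gives the action on an eigenvector, an isometry the passage to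
    a subspace, a square matrix commutation. *)
Lemma expm_intertwine m n (A : 'M[C]_m) (A' : 'M[C]_n) B :
  A *m B = B *m A' -> expm A *m B = B *m expm A'.
Proof.
move=> AB; apply: (@mcvg_unique _ _ (fun k => expsum A k *m B)).
  exact: mcvgMr (mcvg_expsum A).
have -> : (fun k => expsum A k *m B) = (fun k => B *m expsum A' k).
  by apply/funext => k; exact: expsum_intertwine.
exact: mcvgMl (mcvg_expsum A').
Qed.

Lemma expm0 n : expm (0 : 'M[C]_n) = 1.
Proof.
(* The empty partial sum is 0, not 1, so the sequence is shifted by one before it becomes
   constant. *)
apply: expm_unique; rewrite /mcvg -(cvg_shiftS (fun k => nrm (expsum 0 k - 1))).
apply: (@squeeze0 _ (fun=> 0)); last exact: cvg_cst.
move=> k; rewrite /expsum big_ord_recl big1 /= ?addr0 ?expr0 ?fact0 ?invr1 ?scale1r.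
  by rewrite subrr mxnorm10 lexx.
by move=> i _; rewrite exprS mul0r scaler0.
Qed.

(** The square of side [m] is cut along antidiagonals: those with index sum below [m] form the
    Cauchy product, and the remaining corner is the error term. *)
Lemma nat_pairs_split (V : zmodType) (F : nat -> nat -> V) m :
  \sum_(i < m) \sum_(j < m) F i j =
  \sum_(k < m) \sum_(i < k.+1) F i (k - i)%N
   + \sum_(i < m) \sum_(j < m | (m <= i + j)%N) F i j.
Proof.
have -> : \sum_(k < m) \sum_(i < k.+1) F i (k - i)%N =
   \sum_(i < m) \sum_(j < m | (i + j < m)%N) F i j.
  under eq_bigr => k _ do rewrite (big_ord_widen_cond m xpredT (fun i => F i (k - i)%N)) //.
  rewrite (exchange_big_dep xpredT) //=; apply: eq_bigr => i _.
  rewrite -(big_mkord (fun j => (i + j < m)%N) (F i)).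
  rewrite -(big_mkord (fun k => (i < k.+1)%N) (fun k => F i (k - i)%N)).
  rewrite (@big_cat_nat _ _ _ i) //=; last exact: ltnW.
  rewrite big_nat_cond big1 ?add0r; last by move=> k; case/andP; lia.
  rewrite -{1}(add0n (nat_of_ord i)) big_addn.
  rewrite [RHS](@big_cat_nat _ _ _ (m - i)) //=; last exact: leq_subr.
  rewrite [X in _ = _ + X]big_nat_cond [X in _ = _ + X]big1 ?addr0; last first.
    by move=> k /andP[]; lia.
  rewrite big_nat_cond [RHS]big_nat_cond; apply: eq_big => k; first by lia.
  by rewrite addnK.
rewrite -big_split /=; apply: eq_bigr => i _.
rewrite (bigID (fun j : 'I_m => (i + j < m)%N)) /=; congr (_ + _).
by apply: eq_bigl => j; rewrite ltnNge negbK.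
Qed.

Lemma expsumM n (A B : 'M[C]_n) m : A *m B = B *m A ->
  expsum A m *m expsum B m = expsum (A + B) m +
   \sum_(i < m) \sum_(j < m | (m <= i + j)%N)
      ((i`!%:R)^-1 *: A ^+ i) *m ((j`!%:R)^-1 *: B ^+ j).
Proof.
move=> AB; rewrite {1 2}/expsum mulmx_suml.
under eq_bigr => i _ do rewrite mulmx_sumr.
rewrite (nat_pairs_split (fun i j =>
  ((i`!%:R)^-1 *: A ^+ i) *m ((j`!%:R)^-1 *: B ^+ j))); congr (_ + _).
apply: eq_bigr => k _; rewrite addrC exprDn_comm; last exact/esym.
rewrite scaler_sumr; apply: eq_bigr => i _; have ik : (i <= k)%N by rewrite -ltnS.
rewrite -scalemxAl -scalemxAr scalerA -scalerMnr scalerMnl.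
congr (_ *: _).
  have h : ('C(k, i)%:R : C) != 0 by rewrite pnatr_eq0 -lt0n bin_gt0.
  have h1 : (i`!%:R : C) != 0 by rewrite pnatr_eq0 -lt0n fact_gt0.
  have h2 : ((k - i)`!%:R : C) != 0 by rewrite pnatr_eq0 -lt0n fact_gt0.
  by rewrite -(bin_fact ik) !natrM -mulr_natr; field; rewrite h h1 h2.
by apply: commrX; apply/commr_sym/commrX.
Qed.

Lemma real_expsumM (a b : R) m :
  series (exp_coeff a) m * series (exp_coeff b) m = series (exp_coeff (a + b)) m +
   \sum_(i < m) \sum_(j < m | (m <= i + j)%N) exp_coeff a i * exp_coeff b j.
Proof.
have sE c k : series (exp_coeff c) k = \sum_(i < k) exp_coeff c i.
  by rewrite /series /= big_mkord.
rewrite !sE mulr_suml.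
under eq_bigr => i _ do rewrite mulr_sumr.
rewrite (nat_pairs_split (fun i j => exp_coeff a i * exp_coeff b j)); congr (_ + _).
apply: eq_bigr => k _; rewrite addrC /exp_coeff /= exprDn mulr_suml.
apply: eq_bigr => i _; have ik : (i <= k)%N by rewrite -ltnS.
have h : ('C(k, i)%:R : R) != 0 by rewrite pnatr_eq0 -lt0n bin_gt0.
have h1 : (i`!%:R : R) != 0 by rewrite pnatr_eq0 -lt0n fact_gt0.
have h2 : ((k - i)`!%:R : R) != 0 by rewrite pnatr_eq0 -lt0n fact_gt0.
by rewrite -(bin_fact ik) !natrM -mulr_natr; field; rewrite h h1 h2.
Qed.

(* The error of the product of partial sums is dominated by the error for the
   real exponential at the norms, where [expRD] is available. *)
Lemma expmD n (A B : 'M[C]_n) : A *m B = B *m A -> expm (A + B) = expm A *m expm B.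
Proof.
move=> AB; apply/esym.
pose a := nrm A; pose b := nrm B; pose K := nrm (1 : 'M[C]_n).
pose tail k := series (exp_coeff a) k * series (exp_coeff b) k
                 - series (exp_coeff (a + b)) k.
have tail0 : tail k @[k --> \oo] --> (0 : R).
  rewrite -(subrr (expR (a + b))) {1}expRD; apply: cvgB.
    by apply: cvgM; exact: is_cvg_series_exp_coeff.
  exact: is_cvg_series_exp_coeff.
apply: (@mcvg_unique _ _ (fun k => expsum A k *m expsum B k)).
  pose v k := nrm (expsum A k - expm A) * nrm (expsum B k - expm B)
     + nrm (expm A) * nrm (expsum B k - expm B)
     + nrm (expsum A k - expm A) * nrm (expm B).
  apply: (@squeeze0 _ v) => [k|].
    rewrite mxnorm1_ge0 /= /v.
    have -> : expsum A k *m expsum B k - expm A *m expm B =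
      (expsum A k - expm A) *m (expsum B k - expm B)
      + expm A *m (expsum B k - expm B) + (expsum A k - expm A) *m expm B.
      by rewrite -mulmxDl subrK mulmxBr mulmxBl addrA subrK.
    apply: le_trans (mxnorm1D _ _) _; apply: lerD; last exact: mxnorm1M.
    apply: le_trans (mxnorm1D _ _) _; apply: lerD; exact: mxnorm1M.
  have -> : 0 = 0 * 0 + nrm (expm A) * 0 + 0 * nrm (expm B) :> R.
    by rewrite !mulr0 mul0r !addr0.
  apply: cvgD; first apply: cvgD.
  - by apply: cvgM; exact: mcvg_expsum.
  - by apply: cvgMr; exact: mcvg_expsum.
  - by apply: cvgMl; exact: mcvg_expsum.
apply: (@squeeze0 _ (fun k => nrm (expsum (A + B) k - expm (A + B)) + tail k * (K * K))).
  move=> k; rewrite mxnorm1_ge0 /= expsumM // addrAC.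
  apply: le_trans (mxnorm1D _ _) _; rewrite lerD2l.
  rewrite /tail real_expsumM addrAC subrr add0r mulr_suml.
  apply: le_trans (mxnorm1_sum _ _ _) _; apply: ler_sum => i _; rewrite mulr_suml.
  apply: le_trans (mxnorm1_sum _ _ _) _; apply: ler_sum => j _.
  apply: le_trans (mxnorm1M _ _) _; rewrite mulrACA.
  by apply: ler_pM; rewrite ?mxnorm1_ge0 // mxnorm1_expterm.
have -> : 0 = 0 + 0 * (K * K) :> R by rewrite mul0r addr0.
by apply: cvgD; [exact: mcvg_expsum | exact: cvgMl].
Qed.
End MatrixExponential.

(** * The scalar exponential and its values on the imaginary axis *)

Section ScalarExponential.
Local Open Scope classical_set_scope.
Variable R : realType.
Local Notation C := R[i].
Local Notation nc := ComplexField.Normc.normc.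

Lemma cvg_complex_lim (u : nat -> C) (l : C) :
  nc (u k - l) @[k --> \oo] --> (0 : R) -> limn (u : nat -> C^o) = l.
Proof.
move=> /cvg_complexP; apply: (@cvg_lim C^o); exact: norm_hausdorff.
Qed.

Lemma scalar_mxX n (z : C) k : (z%:M : 'M[C]_n) ^+ k = (z ^+ k)%:M.
Proof.
elim: k => [|k IH]; first by rewrite !expr0.
by rewrite !exprS IH -[_ * _]/(_ *m _) -scalar_mxM.
Qed.

Lemma expsum_scalar n (z : C) m :
  expsum (z%:M : 'M[C]_n) m = (\sum_(k < m) (k`!%:R)^-1 * z ^+ k)%:M.
Proof.
rewrite (big_morph (fun c : C => c%:M : 'M[C]_n) (id1 := 0) (op1 := +%R)).
- by apply: eq_bigr => k _; rewrite scalar_mxX scale_scalar_mx.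
- by move=> x y; rewrite raddfD.
- by rewrite raddf0.
Qed.

(** Through 1 by 1 matrices the functional equation is inherited from [expmD]. *)
Lemma cexpE (z : C) : cexp z = expm (z%:M : 'M[C]_1) 0 0.
Proof.
have H := mcvg_expsum (z%:M : 'M[C]_1).
rewrite /cexp; apply: cvg_complex_lim; apply: squeeze0 H => k; rewrite normc_ge0 /=.
apply: le_trans (normc_le_mxnorm1 _ 0 0).
by rewrite expsum_scalar !mxE eqxx.
Qed.

Lemma expm_scalar n (z : C) : expm (z%:M : 'M[C]_n) = (cexp z)%:M.
Proof.
(* A basis column intertwines the scalar matrix of size [n] with the one of size 1. *)
apply/matrixP => i j; pose B : 'M[C]_(n, 1) := delta_mx j 0.
have : expm z%:M *m B = B *m expm (z%:M : 'M[C]_1).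
  by apply: expm_intertwine; rewrite mul_scalar_mx mul_mx_scalar.
move/matrixP => /(_ i 0); rewrite -colE mxE => ->.
by rewrite mxE big_ord1 !mxE eqxx andbT -cexpE mulr_natl.
Qed.

Lemma cexpD (z w : C) : cexp (z + w) = cexp z * cexp w.
Proof.
rewrite !cexpE raddfD /= expmD; last by rewrite scalar_mxC.
by rewrite mxE big_ord1.
Qed.

Lemma cexp0 : cexp (0 : C) = 1.
Proof. by rewrite cexpE raddf0 expm0 mxE. Qed.

Lemma cexp_natmul (z : C) k : cexp (k%:R * z) = cexp z ^+ k.
Proof.
elim: k => [|k IH]; first by rewrite mul0r cexp0 expr0.
by rewrite exprS -IH -cexpD -[k.+1]add1n natrD mulrDl mul1r.
Qed.

Lemma expm_shift n (A : 'M[C]_n) c : expm (A + c%:M) = cexp c *: expm A.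
Proof.
by rewrite expmD ?scalar_mxC // expm_scalar mul_mx_scalar.
Qed.

Lemma expmNK n (A : 'M[C]_n) : expm (- A) *m expm A = 1.
Proof. by rewrite -expmD ?mulNmx ?mulmxN // addNr expm0. Qed.

Lemma expm_natmul n (A : 'M[C]_n) k : expm (k%:R *: A) = expm A ^+ k.
Proof.
elim: k => [|k IH]; first by rewrite scale0r expm0 expr0.
rewrite exprS -IH -[_ * _]/(_ *m _) -expmD; last by rewrite -scalemxAr -scalemxAl.
by rewrite -[k.+1]add1n natrD scalerDl scale1r.
Qed.

Lemma expterm_cis (x : R) k :
  ((k`!%:R)^-1 * ('i * x%:C) ^+ k : C) = cos_coeff x k +i* sin_coeff x k.
Proof.
rewrite exprMn -rmorphXn /=.
have -> : (k`!%:R : C) = (k`!%:R)%:C by rewrite rmorph_nat.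
rewrite -fmorphV /=.
have -> : ('i : C) ^+ k = ((~~ odd k)%:R * (-1) ^+ k./2) +i* ((odd k)%:R * (-1) ^+ k.-1./2).
  have e m : ('i : C) ^+ m.*2 = ((-1) ^+ m)%:C.
    by rewrite -mul2n exprM sqr_i rmorphXn /= rmorphN1.
  rewrite -{1}(odd_double_half k); case: (boolP (odd k)) => ok /=.
    have -> : k.-1./2 = k./2 by rewrite -{1}(odd_double_half k) ok /= add0n doubleK.
    rewrite add1n exprS e; apply/eqP; rewrite eq_complex /=.
    by apply/andP; split; apply/eqP; ring.
  rewrite add0n e mul1r mul0r; apply/eqP; rewrite eq_complex /= eqxx andTb.
  by [].
apply/eqP; rewrite eq_complex /= /cos_coeff /sin_coeff /=.
rewrite -exprnP; apply/andP; split; apply/eqP; ring.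
Qed.

Lemma cexp_cis (x : R) : cexp ('i * x%:C : C) = cos x +i* sin x.
Proof.
rewrite /cexp; apply: cvg_complex_lim.
have sE (F : nat -> R) k : series F k = \sum_(i < k) F i.
  by rewrite /series /= big_mkord.
apply: (@squeeze0 _ _ (fun k => `|series (cos_coeff x) k - cos x| +
                           `|series (sin_coeff x) k - sin x|)).
  move=> k; rewrite normc_ge0 /=; apply: le_trans (normc_le_Re_Im _) _.
  under eq_bigr => i _ do rewrite expterm_cis.
  have -> : \sum_(i < k) (cos_coeff x i +i* sin_coeff x i) =
     series (cos_coeff x) k +i* series (sin_coeff x) k.
    rewrite !sE; elim: k => [|k IH]; first by rewrite !big_ord0.
    by rewrite !big_ord_recr /= IH.
  by rewrite lexx.
have -> : 0 = `|cos x - cos x| + `|sin x - sin x| :> R by rewrite !subrr !normr0 addr0.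
apply: cvgD; apply: cvg_norm; (apply: cvgB; last exact: cvg_cst).
- by rewrite unlock; exact: is_cvg_series_cos_coeff.
- by rewrite unlock; exact: is_cvg_series_sin_coeff.
Qed.

Lemma cexp_ipi : cexp ('i * (pi : R)%:C : C) = -1.
Proof. by rewrite cexp_cis cospi sinpi; apply/eqP; rewrite eq_complex /= oppr0 !eqxx. Qed.

Lemma cexp_conj (x : R) : conjc (cexp ('i * x%:C)) = cexp ('i * (- x)%:C).
Proof. by rewrite !cexp_cis cosN sinN. Qed.

(** Since 1 - cos x = 2 sin^2(x/2), and the half angle lies strictly between 0 and pi. It makes the
    ratio of the geometric sums in [root_sum] different from 1. *)
Lemma cexp_neq1 (x : R) : 0 < x < 2 * pi -> cexp ('i * x%:C) != 1 :> C.
Proof.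
move=> /andP[x0 x2]; apply/negP => /eqP; rewrite cexp_cis => -[c1 _].
have s0 : 0 < sin (x / 2) by apply: sin_gt0_pi; lra.
have xE : x = (x / 2) *+ 2 by rewrite -mulr_natr; lra.
move: c1; rewrite {1}xE cos_mulr2n cos2sin2.
by move: (exprn_gt0 2 s0); rewrite -mulr_natr; lra.
Qed.

End ScalarExponential.

(** * The sign of reordering a word of graded-commuting factors *)

Section SortingSign.

(** [lt] is the original order and [s] the reordered word. Only members of [s] are counted, which
    allows induction on [s] with [lt] fixed. *)
Definition inversions (I : finType) (s : seq I) (lt : rel I) (par : pred I) :=
  [set p : I * I | [&& lt p.1 p.2, par p.1, par p.2, p.1 \in s, p.2 \in s &
                     (index p.2 s < index p.1 s)%N]].

(** As [a] stands in front of all of [s], the new inversions are the pairs [(q, a)] whose [q] came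
    before [a] originally. *)
Lemma card_inversions_cons (I : finType) (lt : rel I) (par : pred I) a (s : seq I) :
  irreflexive lt -> uniq (a :: s) ->
  #|inversions (a :: s) lt par| =
  (par a * count (fun q => lt q a && par q) s + #|inversions s lt par|)%N.
Proof.
move=> ltxx /= /andP[as_ us].
have -> : inversions (a :: s) lt par =
  [set (q, a) | q in [set q | [&& par a, q \in s, lt q a & par q]]] :|: inversions s lt par.
  apply/setP => -[p q]; rewrite !inE /=.
  have -> : ((p, q) \in [set (q, a) | q in [set q | [&& par a, q \in s, lt q a & par q]]])
     = [&& q == a, par a, p \in s, lt p a & par p].
    apply/imsetP/idP => [[x]|/andP[/eqP -> H]]; last by exists p; rewrite ?inE.
    by rewrite inE => H [-> ->]; rewrite eqxx.
  have [->|qa] := eqVneq q a; have [->|pa] := eqVneq p a; rewrite /= ?ltxx ?andbF //.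
  - rewrite (negPf as_) /= !andbF orbF ltn0Sn andbT.
    by case: (lt p a); case: (par a); case: (par p); case: (p \in s).
  - by rewrite (negPf as_) !andbF.
rewrite cardsU disjoint_setI0 ?cards0 ?subn0; last first.
  apply/pred0P => x /=; apply/negP => /andP[/imsetP[q _ ->]].
  by rewrite inE /= (negPf as_) !andbF.
rewrite card_imset; last by move=> x y [].
congr (_ + _)%N; case: (par a) => /=; last first.
  by rewrite mul0n; apply: eq_card0 => q; rewrite inE.
rewrite mul1n -size_filter -(card_uniqP (filter_uniq _ us)).
by apply: eq_card => q; rewrite inE mem_filter andbC.
Qed.

Variables (F : comNzRingType) (n : nat) (I : finType).
Variables (lt : rel I) (par : pred I) (X : I -> 'M[F]_n).
Local Notation M := 'M[F]_n.

Lemma scale_mulmxl a (x y : M) : (a *: x) * y = a *: (x * y).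
Proof. exact/esym/scalemxAl. Qed.

Lemma scale_mulmxr a (x y : M) : x * (a *: y) = a *: (x * y).
Proof. exact/esym/scalemxAr. Qed.

Lemma prod_move_front (s : seq I) a :
  {in s, forall q, X q * X a = (-1) ^+ (par q && par a) *: (X a * X q)} ->
  \prod_(q <- s) X q * X a = (-1) ^+ (par a * count par s) *: (X a * \prod_(q <- s) X q).
Proof.
elim: s => [|q s IH] H; first by rewrite !big_nil muln0 expr0 scale1r mul1r mulr1.
rewrite !big_cons -[LHS]mulrA IH; last by move=> x xs; apply: H; rewrite inE xs orbT.
rewrite scale_mulmxr mulrA H ?inE ?eqxx // scale_mulmxl scalerA -mulrA -exprD.
by congr (_ ^+ _ *: _); rewrite /= mulnDr addnC; case: (par q); case: (par a).
Qed.

Lemma mem_split_uniq (s : seq I) a : uniq s -> a \in s -> 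
  exists s1 s2, [/\ s = s1 ++ a :: s2, a \notin s1 & a \notin s2].
Proof.
move=> us /splitPr H; case: H us => s1 s2; rewrite cat_uniq /= => /and3P[_ + /andP[a2 _]].
by rewrite negb_or => /andP[a1 _]; exists s1, s2.
Qed.

(** Induction on the reordered word: pulling its head [a] out of its original place to the front
    costs a sign for each odd factor passed, when [a] is odd, and these are the new inversions. The
    exchange rule is assumed only for pairs that really get inverted, because factors at equal times
    obey none. *)
Lemma prod_sort_sign (s0 s : seq I) :
  irreflexive lt -> transitive lt -> sorted lt s0 -> uniq s -> {subset s <= s0} ->
  {in s &, forall p q, lt p q -> (index q s < index p s)%N ->
      X p * X q = (-1) ^+ (par p && par q) *: (X q * X p)} ->
  \prod_(q <- s0 | q \in s) X q =
    (-1) ^+ #|inversions s lt par| *: \prod_(q <- s) X q.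
Proof.
move=> irr tr srt; elim: s => [|a s IH] us sub H.
  rewrite big_nil big_pred0 // eq_card0 ?expr0 ?scale1r // => -[p q].
  by rewrite !inE /= !andbF.
have us0 : uniq s0 by apply: sorted_uniq srt.
have as0 : a \in s0 by apply: sub; rewrite inE eqxx.
have [as_ us'] : a \notin s /\ uniq s by move/andP: us.
rewrite card_inversions_cons // big_cons.
have IHs : \prod_(q <- s0 | q \in s) X q =
    (-1) ^+ #|inversions s lt par| *: \prod_(q <- s) X q.
  apply: IH => //; first by move=> x xs; apply: sub; rewrite inE xs orbT.
  move=> p q ps qs pq ilt; apply: H; rewrite ?inE ?ps ?qs ?orbT //=.
  have -> : (a == q) = false by apply: contraNF as_ => /eqP ->.
  by have -> : (a == p) = false by apply: contraNF as_ => /eqP ->.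
have [s1 [s2 [s0E a1 a2]]] := mem_split_uniq us0 as0.
move: IHs; rewrite s0E !big_cat !big_cons inE eqxx (negPf as_) /=.
have memE r : a \notin r ->
    \prod_(q <- r | q \in a :: s) X q = \prod_(q <- [seq q <- r | q \in s]) X q.
  move=> ar; rewrite big_filter big_seq_cond [RHS]big_seq_cond; apply: eq_bigl => q.
  by rewrite inE; have [->|//] := eqVneq q a; rewrite (negPf ar).
rewrite !memE // -!(big_filter _ (fun q => q \in s)).
set u1 := [seq q <- s1 | q \in s]; set u2 := [seq q <- s2 | q \in s] => IHs.
have lt1 q : q \in s1 -> lt q a.
  move: srt; rewrite s0E sorted_pairwise // pairwise_cat => /and3P[/allrelP h _ _] qs.
  by apply: h; rewrite ?inE ?eqxx.
have lt2 q : q \in s2 -> lt a q.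
  move: srt; rewrite s0E sorted_pairwise // pairwise_cat /= => /and4P[_ _ /allP h _] qs.
  exact: h.
rewrite mulrA prod_move_front; last first.
  move=> q; rewrite mem_filter => /andP[qs q1]; apply: H; rewrite ?inE ?eqxx ?qs ?orbT //.
    exact: lt1.
  rewrite /= eqxx; have -> // : (a == q) = false by apply: contraNF as_ => /eqP ->.
rewrite scale_mulmxl -mulrA IHs scale_mulmxr scalerA -exprD; congr (_ ^+ (_ * _ + _) *: _).
(* Both numbers count the odd elements of [s] that precede [a], once by position in [s0] and once by
   [lt]. *)
rewrite -size_filter -(size_filter (fun q => lt q a && par q)).
apply/perm_size/uniq_perm; rewrite ?filter_uniq //.
  by move: us0; rewrite s0E cat_uniq => /and3P[].
move=> q; rewrite !mem_filter; case qs: (q \in s); rewrite ?andbF //= andbT andbC.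
congr (_ && _); have : q \in s0 by apply: sub; rewrite inE qs orbT.
rewrite s0E mem_cat inE; have -> /= : (q == a) = false by apply: contraTF qs => /eqP ->.
case/orP => h; first by rewrite h lt1.
apply/idP/idP => [/lt1 //|qa].
by move: (tr _ _ _ qa (lt2 _ h)); rewrite irr.
Qed.



End SortingSign.

(** * Binary arithmetic of occupation numbers *)

Section Bits.

Lemma occ_split (lo w a j : nat) : (lo < 2 ^ a)%N ->
  occ (lo + 2 ^ a * w) j = if (j < a)%N then occ lo j else occ w (j - a).
Proof.
move=> lo_lt; rewrite /occ; case: ltnP => ja.
  have -> : (2 ^ a * w = (2 ^ (a - j).-1 * w).*2 * 2 ^ j)%N.
    rewrite -mul2n !mulnA -expnS prednK ?subn_gt0 // mulnAC -expnD subnK //.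
    exact: ltnW.
  by rewrite divnDMl ?expn_gt0 // oddD odd_double addbF.
rewrite -{1}(subnKC ja) expnD divnMA [(2 ^ a * w)%N]mulnC divnDMl ?expn_gt0 //.
by rewrite (divn_small lo_lt) add0n.
Qed.

(** The extensionality by which most identities between basis labels are reduced to single bits. *)
Lemma occ_inj x y : occ x =1 occ y -> x = y.
Proof.
have [n] := ubnP (x + y)%N; elim: n x y => // n IH x y xyn xy.
have o0 : odd x = odd y by have := xy 0%N; rewrite /occ !divn1.
have h : x./2 = y./2.
  have [xy0|xy0] := posnP (x + y)%N.
    by move/eqP: xy0; rewrite addn_eq0 => /andP[/eqP -> /eqP ->].
  apply: IH => [|j]; last by have := xy j.+1; rewrite /occ expnS !divnMA !divn2.
  by move: xyn (odd_double_half x) (odd_double_half y); rewrite ltnS; lia.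
by rewrite -(odd_double_half x) -(odd_double_half y) o0 h.
Qed.

Lemma occ0 j : occ 0 j = false.
Proof. by rewrite /occ div0n. Qed.

Lemma occ_lt x M : (x < 2 ^ M)%N <-> (forall j, (M <= j)%N -> occ x j = false).
Proof.
split=> [xM j Mj|H].
  by rewrite /occ divn_small // (leq_trans xM) // leq_exp2l.
suff -> : x = (x %% 2 ^ M)%N by rewrite ltn_mod expn_gt0.
apply: occ_inj => j; rewrite {1}(divn_eq x (2 ^ M)) addnC mulnC occ_split ?ltn_mod ?expn_gt0 //.
case: ltnP => // Mj; have xm : (x %% 2 ^ M < 2 ^ M)%N by rewrite ltn_mod expn_gt0.
have -> : occ (x %% 2 ^ M) j = false.
  by rewrite /occ divn_small // (leq_trans xm) // leq_exp2l.
have := H j Mj; rewrite {1}(divn_eq x (2 ^ M)) addnC mulnC occ_split ?ltn_mod ?expn_gt0 //.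
by rewrite ltnNge Mj.
Qed.

(** One involution describes the effect of creation and of annihilation on labels. The truncated
    subtraction occurs only when bit [m] is set, hence is exact. *)
Definition flip (x m : nat) : nat := if occ x m then (x - 2 ^ m)%N else (x + 2 ^ m)%N.

Lemma occ_bool (b : bool) j : occ b j = (j == 0%N) && b.
Proof.
have /occ_lt H : (b < 2 ^ 1)%N by case: b.
by case: j => [|j]; [case: b H | rewrite H].
Qed.

Lemma bit_decomp x m :
  x = (x %% 2 ^ m + 2 ^ m * (occ x m + 2 ^ 1 * (x %/ 2 ^ m)./2))%N.
Proof.
by rewrite expn1 /occ mul2n odd_double_half mulnC addnC -divn_eq.
Qed.

Lemma flip_decomp x m :
  flip x m = (x %% 2 ^ m + 2 ^ m * ((~~ occ x m) + 2 ^ 1 * (x %/ 2 ^ m)./2))%N.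
Proof.
rewrite /flip; have := bit_decomp x m; case: (occ x m) => /= {1}->.
  by rewrite add0n mulnDr muln1 addnCA addKn.
by rewrite add0n mulnDr muln1; lia.
Qed.

Lemma occ_flip x m j : occ (flip x m) j = occ x j (+) (j == m).
Proof.
have bl (b : bool) : (b < 2 ^ 1)%N by case: b.
have -> : occ x j = if (j < m)%N then occ (x %% 2 ^ m) j else
    occ (occ x m + 2 ^ 1 * (x %/ 2 ^ m)./2) (j - m).
  by rewrite {1}(bit_decomp x m) occ_split ?ltn_mod ?expn_gt0.
rewrite flip_decomp !occ_split ?ltn_mod ?expn_gt0 // !occ_bool.
have [jm|mj|->] := ltngtP j m; rewrite ?addbF ?subnn ?addbT //.
by have -> : (j - m == 0)%N = false by lia.
Qed.

Lemma flipK x m : flip (flip x m) m = x.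
Proof. by apply: occ_inj => j; rewrite !occ_flip -addbA addbb addbF. Qed.

Lemma flipC x m m' : flip (flip x m) m' = flip (flip x m') m.
Proof. by apply: occ_inj => j; rewrite !occ_flip addbAC. Qed.

Lemma flip_lt x m M : (m < M)%N -> (x < 2 ^ M)%N -> (flip x m < 2 ^ M)%N.
Proof.
move=> mM /occ_lt H; apply/occ_lt => j Mj; rewrite occ_flip H //.
by case: eqP => // jm; move: mM; rewrite -jm ltnNge Mj.
Qed.

Lemma exists_occ x M : (x < 2 ^ M)%N -> (0 < x)%N -> exists2 m, (m < M)%N & occ x m.
Proof.
move=> xM x0; case: (pickP (fun m : 'I_M => occ x m)) => [m om|none]; first by exists m.
suff x00 : x = 0%N by rewrite x00 in x0.
apply: occ_inj => j; rewrite occ0; have [jM|Mj] := ltnP j M; first exact: (none (Ordinal jM)).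
by move/occ_lt: xM; apply.
Qed.

(** Overwrites the window of [L] bits of [x] starting at bit [a] with [z]; [bits_get] reads that
    window. *)
Definition bits_put (a L x z : nat) : nat :=
  (x %% 2 ^ a + 2 ^ a * (z + 2 ^ L * (x %/ 2 ^ (a + L))))%N.
Definition bits_get (a L x : nat) : nat := ((x %/ 2 ^ a) %% 2 ^ L)%N.

Lemma bits_put_get a L x : bits_put a L x (bits_get a L x) = x.
Proof.
rewrite /bits_put /bits_get expnD divnMA [(2 ^ L * _)%N]mulnC [(_ %% 2 ^ L + _)%N]addnC.
by rewrite -divn_eq mulnC addnC -divn_eq.
Qed.

Lemma bits_get_lt a L x : (bits_get a L x < 2 ^ L)%N.
Proof. by rewrite ltn_mod expn_gt0. Qed.

Lemma occ_div x a j : occ (x %/ 2 ^ a) j = occ x (a + j).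
Proof. by rewrite /occ -divnMA -expnD. Qed.

Lemma occ_mod x a j : (j < a)%N -> occ (x %% 2 ^ a) j = occ x j.
Proof.
move=> ja; rewrite [in RHS](divn_eq x (2 ^ a)) addnC mulnC occ_split ?ja //.
by rewrite ltn_mod expn_gt0.
Qed.

Lemma occ_put a L x z j : (z < 2 ^ L)%N ->
  occ (bits_put a L x z) j =
    if (j < a)%N then occ x j else if (j < a + L)%N then occ z (j - a) else occ x j.
Proof.
move=> zL; rewrite /bits_put !occ_split ?ltn_mod ?expn_gt0 //.
case: ltnP => ja; first exact: occ_mod.
by rewrite ltn_subLR // occ_div; case: ltnP => // jL; congr occ; lia.
Qed.

Lemma occ_get a L x j : occ (bits_get a L x) j = (j < L)%N && occ x (a + j).
Proof.
case: ltnP => jL; first by rewrite /bits_get occ_mod // occ_div.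
by move/occ_lt: (bits_get_lt a L x); apply.
Qed.

Lemma put_flip a L x z i : (i < L)%N -> (z < 2 ^ L)%N ->
  flip (bits_put a L x z) (a + i) = bits_put a L x (flip z i).
Proof.
move=> iL zL; apply: occ_inj => j; rewrite occ_flip !occ_put ?flip_lt //.
case: ltnP => ja; first by rewrite (_ : (j == _) = false) ?addbF //; lia.
case: ltnP => jL; last by rewrite (_ : (j == _) = false) ?addbF //; lia.
by rewrite occ_flip; congr (_ (+) _); lia.
Qed.

Lemma put_lt a L M x z : (a + L <= M)%N -> (x < 2 ^ M)%N -> (z < 2 ^ L)%N ->
  (bits_put a L x z < 2 ^ M)%N.
Proof.
move=> aLM /occ_lt H zL; apply/occ_lt => j Mj; rewrite occ_put //.
by rewrite !ifF ?H //; lia.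
Qed.

End Bits.

(** * Ladder operators on basis vectors, canonical anticommutation, parity *)

Section JordanWigner.
Variable R : realType.
Local Notation C := R[i].

(** The label is a plain natural number, so that [flip] and [bits_put] apply without bound proofs; a
    label out of range gives the zero vector. *)
Definition ket M (y : nat) : 'cV[C]_(2 ^ M) := \col_x (x == y :> nat)%:R.

Lemma mulmx_ket n M (A : 'M[C]_(n, 2 ^ M)) (y : 'I_(2 ^ M)) : A *m ket M y = col y A.
Proof.
apply/matrixP => i j; rewrite !mxE (bigD1 y) //= big1 => [|k ky]; rewrite !mxE.
  by rewrite eqxx mulr1 addr0.
by rewrite (_ : (k == y :> nat) = false) ?mulr0 //; apply: negbTE.
Qed.

Lemma ket_ext n M (A B : 'M[C]_(n, 2 ^ M)) :
  (forall y, (y < 2 ^ M)%N -> A *m ket M y = B *m ket M y) -> A = B.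
Proof.
move=> H; apply/matrixP => i j; have := H j (ltn_ord j); rewrite !mulmx_ket.
by move/matrixP => /(_ i 0); rewrite !mxE.
Qed.

(** The Jordan--Wigner string; at [m = M] it is the eigenvalue of the parity. *)
Definition occ_sign (m y : nat) : C := (-1) ^+ (\sum_(j < m) occ y j)%N.

Lemma occ_sign_conj m y : conjc (occ_sign m y) = occ_sign m y.
Proof. by rewrite /occ_sign rmorphXn; congr (_ ^+ _); rewrite rmorphN1. Qed.

Lemma occ_sign_sqr m y : occ_sign m y * occ_sign m y = 1.
Proof. by rewrite -expr2 sqrr_sign. Qed.

Lemma eq_occ_sign m x y : (forall j, (j < m)%N -> occ x j = occ y j) ->
  occ_sign m x = occ_sign m y.
Proof. by move=> H; congr (_ ^+ _); apply: eq_bigr => j _; rewrite H. Qed.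

Lemma occ_sign_flip m x j : occ_sign m (flip x j) = (-1) ^+ (j < m)%N * occ_sign m x.
Proof.
have [jm|mj] := ltnP j m; last first.
  rewrite mul1r; apply: eq_occ_sign => k km; rewrite occ_flip (_ : (k == j) = false) ?addbF //.
  by apply/eqP; lia.
rewrite /occ_sign (bigD1 (Ordinal jm)) //= [in RHS](bigD1 (Ordinal jm)) //= occ_flip eqxx addbT.
rewrite (eq_bigr (fun k : 'I_m => occ x k : nat)) => [|k kj].
  rewrite !exprD mulrA; congr (_ * _).
  by case: (occ x j); rewrite ?expr1 ?expr0 ?mulr1 ?mulrNN ?mulr1.
rewrite occ_flip (_ : (nat_of_ord k == j) = false) ?addbF //.
by apply/negP => /eqP h; move/eqP: kj; apply; apply: val_inj.
Qed.

(** The boolean ([true] for creation) lets each relation be proved once for both kinds. *)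
Definition ladder M (m : nat) (b : bool) : 'M[C]_(2 ^ M) :=
  if b then adjmx (ann R M m) else ann R M m.
Arguments ladder : simpl never.

Lemma ladder_ket M m b y : (y < 2 ^ M)%N ->
  ladder M m b *m ket M y =
    if occ y m != b then occ_sign m y *: ket M (flip y m) else 0.
Proof.
move=> yM; rewrite -[y]/(nat_of_ord (Ordinal yM)) mulmx_ket /=.
apply/matrixP => x j; rewrite mxE /ladder; case: b; rewrite /= !mxE /=.
  (* For the adjoint, rows and columns are exchanged, so the condition on [y] has to be solved for
     [x]. *)
  rewrite (_ : occ x m && _ = ~~ occ y m && (x == flip y m :> nat)); last first.
    apply/andP/andP => [[ox /eqP yx]|[oy /eqP ->]].
      have yE : y = flip x m by rewrite /flip ox.
      by rewrite yE flipK eqxx occ_flip eqxx ox.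
    by rewrite occ_flip eqxx addbT oy -[X in X == _](flipK y m) {1}/flip occ_flip eqxx addbT oy.
  case: (boolP (occ y m)) => oy /=; rewrite ?mxE ?oppr0 //.
  case: (nat_of_ord x =P flip y m) => [->|_]; rewrite ?mulr0 ?conjc0 // mulr1 -/(occ_sign _ _) occ_sign_conj.
  by rewrite occ_sign_flip ltnn mul1r.
rewrite /flip; case: (boolP (occ y m)) => oy /=; rewrite ?mxE //.
by case: eqP; rewrite ?mulr1 ?mulr0.
Qed.

Lemma adjmxK n (A : 'M[C]_n) : adjmx (adjmx A) = A.
Proof. by apply/matrixP => i j; rewrite !mxE conjcK. Qed.

Lemma adjmxM n (A B : 'M[C]_n) : adjmx (A *m B) = adjmx B *m adjmx A.
Proof. by rewrite /adjmx map_mxM trmx_mul. Qed.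

Lemma adj_ladder M m b : adjmx (ladder M m b) = ladder M m (~~ b).
Proof. by rewrite /ladder; case: b; rewrite /= ?adjmxK. Qed.

(** The labels commute under flips; the minus sign arises because only the string of the larger mode
    sees the flip of the smaller one. *)
Lemma ladder_anticomm M m m' b b' : (m < M)%N -> (m' < M)%N -> m != m' ->
  ladder M m b *m ladder M m' b' = - (ladder M m' b' *m ladder M m b).
Proof.
wlog lt_mm' : m m' b b' / (m < m')%N => [H mM m'M mm'|mM m'M _].
  have [h|h] := ltnP m m'; first exact: H.
  by rewrite [in RHS]H ?opprK // ?(eq_sym m') // ltn_neqAle eq_sym mm'.
apply: ket_ext => y yM; rewrite mulNmx -!mulmxA !ladder_ket //.
rewrite !(fun_if (mulmx _)) !mulmx0 -!scalemxAr !ladder_ket ?flip_lt //.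
rewrite !occ_flip !occ_sign_flip [m' == m]eq_sym !(ltn_eqF lt_mm') !addbF.
have -> : (m' < m)%N = false by lia.
rewrite lt_mm' mul1r flipC; case: (occ y m != b); case: (occ y m' != b') => /=;
  rewrite ?scaler0 ?oppr0 //.
by rewrite !scalerA -scaleNr; congr (_ *: _); ring.
Qed.

Lemma ladder_sqr M m b : (m < M)%N -> ladder M m b *m ladder M m b = 0.
Proof.
move=> mM; apply: ket_ext => y yM; rewrite mul0mx -mulmxA ladder_ket //.
case: ifP => h; rewrite ?mulmx0 // -scalemxAr ladder_ket ?flip_lt //.
by rewrite occ_flip eqxx addbT; case: (occ y m) b h => [] [] //=; rewrite scaler0.
Qed.

Lemma ladder_car M m b : (m < M)%N ->
  ladder M m b *m ladder M m (~~ b) + ladder M m (~~ b) *m ladder M m b = 1%:M.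
Proof.
move=> mM; apply: ket_ext => y yM; rewrite mul1mx mulmxDl -!mulmxA !ladder_ket //.
rewrite !(fun_if (mulmx _)) !mulmx0 -!scalemxAr !ladder_ket ?flip_lt //.
rewrite !occ_flip !occ_sign_flip !eqxx !addbT ltnn mul1r flipK.
by case: (occ y m) b => [] [] /=; rewrite ?scaler0 ?add0r ?addr0 ?scalerA occ_sign_sqr scale1r.
Qed.

Lemma numop_ket M y : (y < 2 ^ M)%N ->
  numop R M *m ket M y = (\sum_(j < M) occ y j)%N%:R *: ket M y.
Proof.
move=> yM; rewrite mulmx_suml natr_sum scaler_suml; apply: eq_bigr => m _.
have -> : adjmx (ann R M m) *m ann R M m *m ket M y =
    ladder M m true *m (ladder M m false *m ket M y) by rewrite mulmxA.
rewrite ladder_ket //.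
case: (boolP (occ y m)) => om /=; last by rewrite mulmx0 scale0r.
rewrite -scalemxAr ladder_ket ?flip_lt // occ_flip eqxx addbT om /= flipK scalerA.
by rewrite occ_sign_flip ltnn mul1r occ_sign_sqr.
Qed.

Lemma parity_ket M y : (y < 2 ^ M)%N -> parity R M *m ket M y = occ_sign M y *: ket M y.
Proof.
move=> yM; set k := (\sum_(j < M) occ y j)%N.
(* The column [ket M y] intertwines the exponent with a 1 by 1 matrix, since it is an eigenvector of
   [numop]. *)
rewrite /parity (@expm_intertwine _ _ _ _ (k%:R * ('i * (pi : R)%:C))%:M).
  by rewrite expm_scalar cexp_natmul cexp_ipi mul_mx_scalar.
by rewrite -scalemxAl numop_ket // mul_mx_scalar scalerA mulrC.
Qed.

Lemma parity_sqr M : parity R M *m parity R M = 1%:M.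
Proof.
apply: ket_ext => y yM; rewrite -mulmxA parity_ket // -scalemxAr parity_ket //.
by rewrite scalerA occ_sign_sqr scale1r mul1mx.
Qed.

Lemma invmx_parity M : invmx (parity R M) = parity R M.
Proof.
have U : parity R M \in unitmx by case: (mulmx1_unit (parity_sqr M)).
by rewrite -[RHS](mulKmx U) parity_sqr mulmx1.
Qed.

Lemma parity_ladder M m b : (m < M)%N ->
  parity R M *m ladder M m b = - (ladder M m b *m parity R M).
Proof.
move=> mM; apply: ket_ext => y yM; rewrite mulNmx -!mulmxA parity_ket // ladder_ket //.
rewrite -scalemxAr ladder_ket //; case: ifP => _; last by rewrite mulmx0 scaler0 oppr0.
rewrite -scalemxAr parity_ket ?flip_lt // occ_sign_flip mM !scalerA -scaleNr.
by congr (_ *: _); ring.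
Qed.

End JordanWigner.

Arguments ladder : simpl never.

(** * Generation by ladder operators, and the slice homomorphisms *)

Section Slices.
Variable R : realType.
Local Notation C := R[i].
Local Notation ket := (ket R).
Local Notation ladder := (ladder R).

Lemma ket_dot M x z : (x < 2 ^ M)%N -> (z < 2 ^ M)%N ->
  (ket M x)^T *m ket M z = (x == z)%:R%:M.
Proof.
move=> xM zM; rewrite -[z]/(nat_of_ord (Ordinal zM)) mulmx_ket.
by apply/matrixP => i j; rewrite !ord1 !mxE /= mulr1n eq_sym.
Qed.

Definition outer M x y : 'M[C]_(2 ^ M) := ket M x *m (ket M y)^T.

Lemma outer_ket M x y z : (y < 2 ^ M)%N -> (z < 2 ^ M)%N ->
  outer M x y *m ket M z = (y == z)%:R *: ket M x.
Proof. by move=> yM zM; rewrite /outer -mulmxA ket_dot // mul_mx_scalar. Qed.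

Lemma outerM M x y z w : (y < 2 ^ M)%N -> (z < 2 ^ M)%N ->
  outer M x y *m outer M z w = (y == z)%:R *: outer M x w.
Proof. by move=> yM zM; rewrite mulmxA outer_ket // -scalemxAl. Qed.

Lemma outer_delta M (x y : 'I_(2 ^ M)) : outer M x y = delta_mx x y.
Proof.
apply/matrixP => i j; rewrite !mxE big_ord1 !mxE -natrM mulnb.
by congr ((_ && _)%:R).
Qed.

Lemma adj_outer M x y : adjmx (outer M x y) = outer M y x.
Proof.
apply/matrixP => i j; rewrite !mxE !big_ord1 !mxE rmorphM mulrC.
by congr (_ * _); exact: conjc_nat.
Qed.

Lemma prod_unocc_ket M (s : seq 'I_M) z : (z < 2 ^ M)%N ->
  (\prod_(m <- s) (ladder M m false *m ladder M m true)) *m ket M z =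
    (all (fun m : 'I_M => ~~ occ z m) s)%:R *: ket M z.
Proof.
move=> zM; elim: s => [|m s IH]; first by rewrite big_nil -[1]/(1%:M) mul1mx scale1r.
rewrite big_cons -[_ * _]/(_ *m _) -mulmxA IH /= -scalemxAr -mulmxA ladder_ket //.
case: (boolP (occ z m)) => om /=; first by rewrite mulmx0 scaler0 scale0r.
rewrite -scalemxAr ladder_ket ?flip_lt // occ_flip eqxx addbT om /= flipK.
by rewrite occ_sign_flip ltnn mul1r [X in _ *: X]scalerA occ_sign_sqr scale1r.
Qed.

(** Each factor projects on one mode being empty. The point is that the vacuum projector is a
    polynomial in the ladder operators, from which all matrix units are then generated. *)
Lemma vacuum_projector M :
  \prod_(m < M) (ladder M m false *m ladder M m true) = outer M 0 0.
Proof.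
have M0 : (0 < 2 ^ M)%N by rewrite expn_gt0.
apply: ket_ext => z zM; rewrite prod_unocc_ket // outer_ket //.
case: eqP => [<-|z0].
  by rewrite (eq_all (a2 := predT)) ?all_predT // => m; rewrite occ0.
case: (exists_occ zM) => [|m mM om]; first by rewrite lt0n; apply/eqP => h; apply: z0.
case: allP => [H|_]; last by rewrite !scale0r.
by have := H (Ordinal mM) (mem_index_enum _); rewrite /= om.
Qed.

Lemma outer_raise M x y m b : (x < 2 ^ M)%N -> occ x m != b ->
  ladder M m b *m outer M x y = occ_sign R m x *: outer M (flip x m) y.
Proof. by move=> xM h; rewrite /outer mulmxA ladder_ket // h -scalemxAl. Qed.

(** The ladder operators generate the full matrix algebra. Matrix units factor through the vacuum as
    |i><0| times |0><j|; |i><0| is built by creation operators from the vacuum projector, and |0><j|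
    is the adjoint of such a product. *)
Lemma ladder_ind M (K : 'M[C]_(2 ^ M) -> Prop) :
  K 1%:M -> (forall A B, K A -> K B -> K (A + B)) -> (forall c A, K A -> K (c *: A)) ->
  (forall (i : 'I_M) b A, K A -> K (ladder M i b *m A)) -> forall A, K A.
Proof.
(* [K] itself is not assumed closed under products, but the left multipliers that preserve [K] are,
   and they contain the generators. *)
move=> K1 KD KZ KL; pose K' A := forall B, K B -> K (A *m B).
have K'D A B : K' A -> K' B -> K' (A + B).
  by move=> KA KB D KD'; rewrite mulmxDl; apply: KD; [exact: KA | exact: KB].
have K'Z c A : K' A -> K' (c *: A).
  by move=> KA D KD'; rewrite -scalemxAl; apply: KZ; exact: KA.
have K'M A B : K' A -> K' B -> K' (A *m B).
  by move=> KA KB D KD'; rewrite -mulmxA; apply: KA; exact: KB.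
have K'L (i : 'I_M) b : K' (ladder M i b) by move=> A; exact: KL.
have M0 : (0 < 2 ^ M)%N by rewrite expn_gt0.
have K'vac : K' (outer M 0 0).
  rewrite -vacuum_projector; apply: big_ind => //; last by move=> i _; exact: K'M.
  by move=> B KB; rewrite -[1]/(1%:M) mul1mx.
(* Emptying one occupied mode strictly lowers the label, which drives the induction on [x]. *)
have step x (xM : (x < 2 ^ M)%N) : (0 < x)%N -> exists m : 'I_M, exists2 x' : nat,
    (x' < x)%N & forall y, outer M x y = occ_sign R m x' *: (ladder M m true *m outer M x' y).
  move=> x0; case: (exists_occ xM x0) => m mM om.
  exists (Ordinal mM), (flip x m) => [|y].
    by rewrite /flip om ltn_subrL expn_gt0 x0.
  rewrite outer_raise ?flip_lt ?occ_flip ?eqxx ?om // flipK scalerA.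
  by rewrite occ_sign_sqr scale1r.
have K'x : forall n x, (x < n)%N -> (x < 2 ^ M)%N -> K' (outer M x 0) /\ K' (outer M 0 x).
  elim=> // n IH x xn xM; have [->|x0] := posnP x; first by [].
  case: (step x xM x0) => m [x' x'x E].
  have [IH1 IH2] : K' (outer M x' 0) /\ K' (outer M 0 x').
    by apply: IH; [exact: leq_trans x'x _ | exact: ltn_trans x'x xM].
  split; first by rewrite E; apply: K'Z; exact: K'M.
  rewrite -adj_outer E.
  have -> : adjmx (occ_sign R m x' *: (ladder M m true *m outer M x' 0)) =
     occ_sign R m x' *: (outer M 0 x' *m ladder M m false).
    rewrite -(adj_outer M x' 0) -(adj_ladder R M m true) -adjmxM.
    by apply/matrixP => i j; rewrite !mxE rmorphM /= occ_sign_conj.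
  by apply: K'Z; exact: K'M.
move=> A; rewrite -[A]mulmx1; apply: (_ : K' A) => //.
rewrite [A]matrix_sum_delta; apply: big_ind => [||i _] //.
  by move=> B KB; rewrite mul0mx -(scale0r B); exact: KZ.
apply: big_ind => [||j _] //; first by move=> B KB; rewrite mul0mx -(scale0r B); exact: KZ.
apply: K'Z; rewrite -outer_delta -[outer M i j]scale1r.
have -> : 1 *: outer M i j = outer M i 0 *m outer M 0 j by rewrite outerM // eqxx.
have [] := K'x _ i (ltnSn i) (ltn_ord i); have [] := K'x _ j (ltnSn j) (ltn_ord j).
by move=> _ h1 h2 _; exact: K'M.
Qed.

Lemma gen_hE L (l : 'I_L * bool) : gen_h R l = ladder L l.1 l.2.
Proof. by []. Qed.

Lemma gen_HE L N t (l : 'I_L * bool) : gen_H R N t l = ladder (L * N) (t * L + l.1) l.2.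
Proof. by []. Qed.

(** Ensures that the choice inside [slice] returns a polynomial that represents the operator. *)
Lemma eval_h_surj L (A : 'M[C]_(2 ^ L)) : exists p : ncpoly R L, eval_h p = A.
Proof.
elim/ladder_ind: A => [|A B [p <-] [q <-]|c A [p <-]|i b A [p <-]].
- by exists [:: (1, [::])]; rewrite /eval_h big_seq1 big_nil scale1r.
- by exists (p ++ q); rewrite /eval_h big_cat.
- exists [seq (c * mo.1, mo.2) | mo <- p]; rewrite /eval_h big_map scaler_sumr.
  by apply: eq_bigr => mo _; rewrite scalerA.
- exists [seq (mo.1, (i, b) :: mo.2) | mo <- p]; rewrite /eval_h big_map mulmx_sumr.
  by apply: eq_bigr => mo _; rewrite big_cons -scalemxAr.
Qed.

(* Isometry of [h] onto the states of [H] whose modes outside the block of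
   [L] modes starting at [a] are occupied as in [x]; the sign accounts for the
   Jordan--Wigner string of the modes below [a]. *)
Definition block_embed M a L x : 'M[C]_(2 ^ M, 2 ^ L) :=
  \matrix_(y, z) (occ_sign R L z ^+ (\sum_(j < a) occ x j)%N
                  * (y == bits_put a L x z :> nat)%:R).

Lemma block_embed_ket M a L x z : (z < 2 ^ L)%N ->
  block_embed M a L x *m ket L z =
    occ_sign R L z ^+ (\sum_(j < a) occ x j)%N *: ket M (bits_put a L x z).
Proof.
move=> zL; rewrite -[z]/(nat_of_ord (Ordinal zL)) mulmx_ket.
by apply/matrixP => i j; rewrite !mxE.
Qed.

Lemma occ_sign_put a L x z i : (i <= L)%N -> (z < 2 ^ L)%N ->
  occ_sign R (a + i) (bits_put a L x z) = occ_sign R a x * occ_sign R i z.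
Proof.
move=> iL zL; rewrite /occ_sign big_split_ord exprD; congr (_ ^+ _ * _ ^+ _).
  by apply: eq_bigr => j _; rewrite occ_put //= ltn_ord.
apply: eq_bigr => j _; rewrite occ_put //= ltnNge leq_addr /= ltn_add2l.
by rewrite (leq_trans (ltn_ord j) iL) addKn.
Qed.

(** The string of mode [a + i] exceeds that of mode [i] by the constant [occ_sign R a x]. A flip
    changes the parity of [z], and the power of that parity in [block_embed] then produces exactly
    this factor. *)
Lemma block_embed_ladder M a L x i b : (a + L <= M)%N -> (x < 2 ^ M)%N -> (i < L)%N ->
  ladder M (a + i) b *m block_embed M a L x = block_embed M a L x *m ladder L i b.
Proof.
move=> aLM xM iL; apply: ket_ext => z zL; rewrite -!mulmxA block_embed_ket // ladder_ket //.
rewrite -scalemxAr ladder_ket; last exact: put_lt.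
rewrite occ_put // ltnNge leq_addr /= ltn_add2l iL addKn.
case: ifP => _; last by rewrite mulmx0 scaler0.
rewrite -scalemxAr block_embed_ket ?flip_lt // put_flip // occ_sign_put //; last exact: ltnW.
rewrite occ_sign_flip iL exprMn !scalerA; congr (_ *: _).
by rewrite expr1 /(occ_sign R a x); ring.
Qed.

(** Each basis vector [ket M x] lies, up to sign, in the range of its own embedding, at the label
    [bits_get a L x]. *)
Lemma block_embed_ext n M a L (A B : 'M[C]_(n, 2 ^ M)) :
  (forall x, (x < 2 ^ M)%N -> A *m block_embed M a L x = B *m block_embed M a L x) -> A = B.
Proof.
move=> H; apply: ket_ext => x xM; set z := bits_get a L x.
have zL : (z < 2 ^ L)%N by exact: bits_get_lt.
set k := (\sum_(j < a) occ x j)%N.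
have -> : ket M x = occ_sign R L z ^+ k *: (block_embed M a L x *m ket L z).
  rewrite block_embed_ket // bits_put_get scalerA -exprMn occ_sign_sqr expr1n.
  by rewrite scale1r.
by rewrite -!scalemxAr !mulmxA H.
Qed.

Variables (L N : nat).
Implicit Types (A B : 'M[C]_(2 ^ L)) (t : nat).

Lemma slice_fits t : (t < N)%N -> (t * L + L <= L * N)%N.
Proof. by move=> tN; rewrite addnC -mulSn mulnC leq_mul2l tN orbT. Qed.

Lemma slice_mode t i : (t < N)%N -> (i < L)%N -> (t * L + i < L * N)%N.
Proof. by move=> tN iL; apply: leq_trans (slice_fits tN); rewrite ltn_add2l. Qed.

Lemma eval_block_embed t (p : ncpoly R L) x : (t < N)%N -> (x < 2 ^ (L * N))%N ->
  eval_H N t p *m block_embed (L * N) (t * L) L x =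
    block_embed (L * N) (t * L) L x *m eval_h p.
Proof.
move=> tN xM; rewrite /eval_H /eval_h mulmx_suml mulmx_sumr; apply: eq_bigr => mo _.
rewrite -scalemxAl -scalemxAr; congr (_ *: _); elim: mo.2 => [|l w IH].
  by rewrite !big_nil -![1]/(1%:M) mul1mx mulmx1.
rewrite !big_cons -![_ * _]/(_ *m _) -mulmxA IH !mulmxA gen_hE gen_HE.
by rewrite block_embed_ladder // slice_fits.
Qed.

(** With [block_embed_ext] this pins down [slice N t A] whatever polynomial was chosen; linearity,
    multiplicativity and compatibility with [expm] all follow from it. *)
Lemma slice_block_embed t A x : (t < N)%N -> (x < 2 ^ (L * N))%N ->
  slice N t A *m block_embed (L * N) (t * L) L x = block_embed (L * N) (t * L) L x *m A.
Proof.
move=> tN xM; rewrite /slice eval_block_embed //.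
by rewrite (epsilon_spec (inhabits [::]) _ (eval_h_surj A)).
Qed.

Lemma sliceD t A B : (t < N)%N -> slice N t (A + B) = slice N t A + slice N t B.
Proof.
move=> tN; apply: (@block_embed_ext _ _ (t * L) L) => x xM.
by rewrite mulmxDl !slice_block_embed // mulmxDr.
Qed.

Lemma sliceZ t c A : (t < N)%N -> slice N t (c *: A) = c *: slice N t A.
Proof.
move=> tN; apply: (@block_embed_ext _ _ (t * L) L) => x xM.
by rewrite -scalemxAl !slice_block_embed // scalemxAr.
Qed.

Lemma sliceM t A B : (t < N)%N -> slice N t (A *m B) = slice N t A *m slice N t B.
Proof.
move=> tN; apply: (@block_embed_ext _ _ (t * L) L) => x xM.
by rewrite -mulmxA !slice_block_embed // [RHS]mulmxA slice_block_embed // mulmxA.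
Qed.

Lemma slice1 t : (t < N)%N -> slice N t (1%:M : 'M[C]_(2 ^ L)) = 1%:M.
Proof.
by move=> tN; apply: (@block_embed_ext _ _ (t * L) L) => x xM; rewrite slice_block_embed // mul1mx mulmx1.
Qed.

Lemma slice_ladder t i b : (t < N)%N -> (i < L)%N ->
  slice N t (ladder L i b) = ladder (L * N) (t * L + i) b.
Proof.
move=> tN iL; apply: (@block_embed_ext _ _ (t * L) L) => x xM.
by rewrite slice_block_embed // block_embed_ladder // slice_fits.
Qed.

Lemma slice_expm t A : (t < N)%N -> slice N t (expm A) = expm (slice N t A).
Proof.
move=> tN; apply: (@block_embed_ext _ _ (t * L) L) => x xM; rewrite slice_block_embed //.
by apply/esym/expm_intertwine; rewrite slice_block_embed.
Qed.

Lemma slice_vacuum_ket t x : (t < N)%N -> (x < 2 ^ (L * N))%N ->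
  slice N t (outer L 0 0) *m ket (L * N) x =
    (bits_get (t * L) L x == 0)%N%:R *: ket (L * N) x.
Proof.
move=> tN xM; set z := bits_get _ _ _; set k := (\sum_(j < t * L) occ x j)%N.
have zL : (z < 2 ^ L)%N by exact: bits_get_lt.
have {1}-> : ket (L * N) x =
    occ_sign R L z ^+ k *: (block_embed (L * N) (t * L) L x *m ket L z).
  rewrite block_embed_ket // bits_put_get scalerA -exprMn occ_sign_sqr expr1n.
  by rewrite scale1r.
rewrite -scalemxAr mulmxA slice_block_embed // -mulmxA outer_ket ?expn_gt0 //.
rewrite eq_sym; case: eqP => [z0|_]; last by rewrite !scale0r mulmx0 scaler0.
have -> : ket L 0 = ket L z by rewrite z0.
rewrite !scale1r block_embed_ket // bits_put_get scalerA -exprMn occ_sign_sqr.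
by rewrite expr1n scale1r.
Qed.

(** The grading automorphism: [parity] is its own inverse. *)
Definition parity_conj M (A : 'M[C]_(2 ^ M)) := parity R M *m A *m parity R M.

Lemma parity_conjM M (A B : 'M[C]_(2 ^ M)) :
  parity_conj (A *m B) = parity_conj A *m parity_conj B.
Proof.
by rewrite /parity_conj !mulmxA -(mulmxA _ (parity R M) (parity R M)) parity_sqr mulmx1.
Qed.

Lemma parity_conjK M : involutive (@parity_conj M).
Proof.
move=> A; rewrite /parity_conj !mulmxA parity_sqr mul1mx -mulmxA parity_sqr.
by rewrite mulmx1.
Qed.

Lemma parity_conj_ladder M m b : (m < M)%N -> parity_conj (ladder M m b) = - ladder M m b.
Proof.
by move=> mM; rewrite /parity_conj parity_ladder // mulNmx -mulmxA parity_sqr mulmx1.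
Qed.

Lemma parity_conj1 M : parity_conj (1%:M : 'M[C]_(2 ^ M)) = 1%:M.
Proof. by rewrite /parity_conj mulmx1 parity_sqr. Qed.

Lemma parity_conjD M (A B : 'M[C]_(2 ^ M)) :
  parity_conj (A + B) = parity_conj A + parity_conj B.
Proof. by rewrite /parity_conj mulmxDr mulmxDl. Qed.

Lemma parity_conjZ M c (A : 'M[C]_(2 ^ M)) : parity_conj (c *: A) = c *: parity_conj A.
Proof. by rewrite /parity_conj -scalemxAr -scalemxAl. Qed.

(** As [phi] is a unital algebra map, [ladder_ind] reduces the claim to generators. It is applied
    with the identity and with [parity_conj]. *)
Lemma slice_intertwine t t' (T : 'M[C]_(2 ^ (L * N))) (phi : 'M[C]_(2 ^ L) -> 'M[C]_(2 ^ L)) :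
  (t < N)%N -> (t' < N)%N ->
  phi 1%:M = 1%:M -> (forall A B, phi (A + B) = phi A + phi B) ->
  (forall c A, phi (c *: A) = c *: phi A) -> (forall A B, phi (A *m B) = phi A *m phi B) ->
  (forall (i : 'I_L) b, T *m slice N t (ladder L i b) = slice N t' (phi (ladder L i b)) *m T) ->
  forall A, T *m slice N t A = slice N t' (phi A) *m T.
Proof.
move=> tN t'N p1 pD pZ pM H; elim/ladder_ind => [|A B IHA IHB|c A IH|i b A IH].
- by rewrite p1 !slice1 // mulmx1 mul1mx.
- by rewrite pD !sliceD // mulmxDr mulmxDl IHA IHB.
- by rewrite pZ !sliceZ // -scalemxAr -scalemxAl IH.
- by rewrite pM !sliceM // mulmxA H -mulmxA IH mulmxA.
Qed.

Lemma slice_ladder_comm t t' i b A : (t < N)%N -> (t' < N)%N -> t != t' -> (i < L)%N ->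
  slice N t' (ladder L i b) *m slice N t A =
    slice N t (parity_conj A) *m slice N t' (ladder L i b).
Proof.
move=> tN t'N tt' iL; apply: (@slice_intertwine _ _ _ (@parity_conj L)) => //.
- exact: parity_conj1.
- exact: parity_conjD.
- exact: parity_conjZ.
- exact: parity_conjM.
move=> j b'; rewrite parity_conj_ladder // -scaleN1r sliceZ // !slice_ladder //.
rewrite -scalemxAl scaleN1r ladder_anticomm ?slice_mode //.
(* Division by [L] recovers the slice from the mode number. *)
apply/negP => /eqP h; have h2 : ((t * L + j) %/ L = (t' * L + i) %/ L)%N by rewrite h.
have L0 : (0 < L)%N by exact: leq_trans iL.
by move: h2 tt'; rewrite !divnMDl // !divn_small // !addn0 => ->; rewrite eqxx.
Qed.

Lemma parity_slice t A : (t < N)%N ->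
  parity R (L * N) *m slice N t A = slice N t (parity_conj A) *m parity R (L * N).
Proof.
move=> tN; apply: (@slice_intertwine _ _ _ (@parity_conj L)) => //.
- exact: parity_conj1.
- exact: parity_conjD.
- exact: parity_conjZ.
- exact: parity_conjM.
move=> i b; rewrite parity_conj_ladder // -scaleN1r sliceZ // !slice_ladder //.
by rewrite parity_ladder ?slice_mode // -scalemxAl scaleN1r.
Qed.

Lemma parity_conj_slice t A : (t < N)%N ->
  parity_conj (slice N t A) = slice N t (parity_conj A).
Proof. by move=> tN; rewrite /parity_conj parity_slice // -mulmxA parity_sqr mulmx1. Qed.

Lemma slice_even_comm t t' A B : (t < N)%N -> (t' < N)%N -> t != t' ->
  parity_conj A = A -> slice N t' B *m slice N t A = slice N t A *m slice N t' B.
Proof.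
move=> tN t'N tt' Ae; elim/ladder_ind: B => [|B B' IH IH'|c B IH|i b B IH].
- by rewrite slice1 // mulmx1 mul1mx.
- by rewrite sliceD // mulmxDr mulmxDl IH IH'.
- by rewrite sliceZ // -scalemxAr -scalemxAl IH.
- by rewrite sliceM // -mulmxA IH !mulmxA slice_ladder_comm // Ae.
Qed.

(** Placing the grading on [B] states graded commutation for [B] of mixed parity. *)
Lemma slice_odd_comm t t' A B : (t < N)%N -> (t' < N)%N -> t != t' ->
  parity_conj A = - A ->
  slice N t' (parity_conj B) *m slice N t A = slice N t A *m slice N t' B.
Proof.
move=> tN t'N tt' Ao; elim/ladder_ind: B => [|B B' IH IH'|c B IH|i b B IH].
- by rewrite parity_conj1 slice1 // mulmx1 mul1mx.
- by rewrite parity_conjD !sliceD // mulmxDr mulmxDl IH IH'.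
- by rewrite parity_conjZ !sliceZ // -scalemxAr -scalemxAl IH.
- rewrite parity_conjM (sliceM (parity_conj (ladder L i b))) // (sliceM (ladder L i b)) //.
  rewrite -mulmxA IH !mulmxA parity_conj_ladder //.
  rewrite -scaleN1r sliceZ // -scalemxAl slice_ladder_comm // Ao -(scaleN1r A) sliceZ //.
  by rewrite -!scalemxAl scalerA mulrNN mulr1 scale1r.
Qed.

End Slices.



(** * Fourier modes and the translation operator *)

Section Translation.
Variable R : realType.
Local Notation C := R[i].
Local Notation ket := (ket R).
Local Notation ladder := (ladder R).

Lemma ladder_anticommutator M m m' b b' : (m < M)%N -> (m' < M)%N ->
  ladder M m b *m ladder M m' b' + ladder M m' b' *m ladder M m b =
    ((m == m') && (b != b'))%:R%:M.
Proof.
move=> mM m'M; have [<-|mm'] := eqVneq m m'; last first.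
  by rewrite ladder_anticomm // addNr raddf0.
have [<-|bb'] := eqVneq b b'; first by rewrite ladder_sqr // addr0 raddf0.
have -> : b' = ~~ b by case: b b' bb' => [] [].
by rewrite ladder_car.
Qed.

Variables (L N : nat) (eps : R).
Hypotheses (N_gt0 : (0 < N)%N) (eps_gt0 : 0 < eps).

Definition fourier (n t : nat) : C :=
  ((Num.sqrt (N%:R : R))^-1)%:C * cexp ('i * (omega N eps n * eps * t%:R)%:C).

Definition fourier_c (n t : nat) (b : bool) : C :=
  if b then fourier n t else conjc (fourier n t).

Lemma conj_fourier_c n t b : conjc (fourier_c n t b) = fourier_c n t (~~ b).
Proof. by case: b; rewrite /= ?conjcK. Qed.

(** Both the factor that a mode of type [b] acquires when the translation passes it and the ratio of
    its coefficients at consecutive times. That these agree is why the translation is a shift. *)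
Definition phase (n : nat) (b : bool) : C :=
  cexp ('i * ((-1) ^+ (~~ b) * (omega N eps n * eps))%:C).

Lemma fourier_cS n t b : fourier_c n t.+1 b = phase n b * fourier_c n t b.
Proof.
have E : fourier n t.+1 = phase n true * fourier n t.
  rewrite /fourier /phase mulrCA -cexpD; congr (_ * cexp _).
  by rewrite -mulrDr -rmorphD; congr (_ * _%:C); rewrite -natr1; ring.
rewrite /fourier_c; case: b => //; rewrite E rmorphM /=; congr (_ * _).
rewrite -[LHS]/(conjc (phase n true)) /phase cexp_conj.
by congr (cexp (_ * _%:C)); rewrite /= expr0 expr1; ring.
Qed.

(** Over the whole period the phase is (2n + 1) pi: antiperiodicity in time, the origin of the
    parity twist. *)
Lemma fourier_cN n b : fourier_c n N b = - fourier_c n 0 b.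
Proof.
have N0 : (N%:R : R) != 0 by rewrite pnatr_eq0 -lt0n.
have e0 : eps != 0 by rewrite gt_eqF.
have E : fourier n N = - fourier n 0.
  rewrite /fourier mulr0 rmorph0 mulr0 cexp0 mulr1 -mulrN1; congr (_ * _).
  have -> : 'i * (omega N eps n * eps * N%:R)%:C =
      (2 * n + 1)%:R * ('i * (pi : R)%:C) :> C.
    have -> : omega N eps n * eps * N%:R = (2 * n + 1)%:R * pi.
      by rewrite /omega natrD natrM; field; rewrite N0 e0.
    by rewrite rmorphM rmorph_nat; ring.
  by rewrite cexp_natmul cexp_ipi exprD mulnC exprM expr1 -exprM mulnC exprM sqrrN expr1n expr1n mul1r.
by rewrite /fourier_c; case: b; rewrite E // rmorphN.
Qed.

Definition fourier_mx : 'M[C]_N := \matrix_(n, t) fourier n t.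

(** A geometric sum whose ratio is a nontrivial [N]-th root of unity. Assuming [m < n] keeps [n - m]
    exact; conjugation gives the other order. *)
Lemma root_sum (n m : nat) : (m < n < N)%N ->
  \sum_(t < N) cexp ('i * ((omega N eps n - omega N eps m) * eps * t%:R)%:C) = 0 :> C.
Proof.
move=> /andP[mn nN].
have N0 : (N%:R : R) != 0 by rewrite pnatr_eq0 -lt0n.
have Np : 0 < (N%:R : R) by rewrite ltr0n.
have e0 : eps != 0 by rewrite gt_eqF.
pose x : R := 2 * pi * (n - m)%:R / N%:R.
have xE : (omega N eps n - omega N eps m) * eps = x.
  by rewrite /x /omega natrB ?(ltnW mn) //; field; rewrite N0 e0.
pose q : C := cexp ('i * x%:C).
rewrite (eq_bigr (fun t : 'I_N => q ^+ t)); last first.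
  move=> t _; rewrite xE /q -cexp_natmul; congr cexp.
  by rewrite rmorphM rmorph_nat; ring.
have q1 : q != 1.
  apply: cexp_neq1; rewrite /x; have p0 := pi_gt0 R.
  have d0 : 0 < ((n - m)%:R : R) by rewrite ltr0n subn_gt0.
  rewrite divr_gt0 ?mulr_gt0 //= ltr_pdivrMr // ltr_pM2l ?mulr_gt0 //.
  by rewrite ltr_nat; apply: leq_ltn_trans nN; exact: leq_subr.
apply: (mulfI (_ : q - 1 != 0)); first by rewrite subr_eq0.
rewrite -subrX1 mulr0 /q -cexp_natmul.
have -> : N%:R * ('i * x%:C) = (2 * (n - m))%:R * ('i * (pi : R)%:C) :> C.
  have -> : x%:C = (2 * (n - m))%:R * (pi : R)%:C / N%:R :> C.
    by rewrite /x !rmorphM fmorphV !rmorph_nat natrM; ring.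
  by field; rewrite pnatr_eq0 -lt0n.
by rewrite cexp_natmul cexp_ipi exprM sqrrN expr1n expr1n subrr.
Qed.

Lemma fourier_orth_rows (n m : 'I_N) :
  \sum_(t < N) fourier n t * conjc (fourier m t) = (n == m)%:R.
Proof.
have N0 : (N%:R : R) != 0 by rewrite pnatr_eq0 -lt0n.
have conjM (a b : C) : conjc (a * b) = conjc a * conjc b by exact: rmorphM.
have term (k l : nat) t : fourier k t * conjc (fourier l t) =
    (N%:R)^-1 * cexp ('i * ((omega N eps k - omega N eps l) * eps * t%:R)%:C).
  rewrite /fourier conjM cexp_conj mulrACA -cexpD; congr (_ * cexp _).
    rewrite conjc_real -rmorphM -invfM -expr2 sqr_sqrtr ?ler0n //.
    by rewrite fmorphV rmorph_nat.
  by rewrite -mulrDr -rmorphD; congr (_ * _%:C); ring.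
have [<-|nm] := eqVneq n m.
  rewrite (eq_bigr (fun=> (N%:R)^-1)) => [|t _].
    by rewrite sumr_const card_ord -[_ *+ _]mulr_natl mulfV // pnatr_eq0 -lt0n.
  by rewrite term subrr !mul0r rmorph0 mulr0 cexp0 mulr1.
have [h|h|h] := ltngtP m n; last by case/eqP: nm; apply: val_inj.
  under eq_bigr => t _ do rewrite term.
  by rewrite -mulr_sumr root_sum ?mulr0 // h ltn_ord.
rewrite (eq_bigr (fun t : 'I_N => conjc (fourier m t * conjc (fourier n t)))); last first.
  by move=> t _; rewrite conjM conjcK mulrC.
under eq_bigr => t _ do rewrite term.
by rewrite -rmorph_sum -mulr_sumr root_sum ?h ?ltn_ord // mulr0 rmorph0.
Qed.

(** A one-sided inverse of a square matrix is two-sided, so orthonormal rows give orthonormal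
    columns. *)
Lemma fourier_orth_cols (t t' : 'I_N) :
  \sum_(n < N) conjc (fourier n t) * fourier n t' = (t == t')%:R.
Proof.
have U : fourier_mx *m adjmx fourier_mx = 1%:M.
  apply/matrixP => n m; rewrite !mxE -fourier_orth_rows.
  by apply: eq_bigr => k _; rewrite !mxE.
have /matrixP /(_ t t') := mulmx1C U; rewrite !mxE => <-.
by apply: eq_bigr => n _; rewrite !mxE.
Qed.

Definition mode (n j : nat) (b : bool) : 'M[C]_(2 ^ (L * N)) :=
  \sum_(t < N) fourier_c n t (~~ b) *: ladder (L * N) (t * L + j) b.

Lemma ahatE n j : ahat L N eps n j = mode n j false.
Proof.
by rewrite /ahat /mode scaler_sumr; apply: eq_bigr => t _; rewrite scalerA.
Qed.

Lemma adjmxZ n c (A : 'M[C]_n) : adjmx (c *: A) = conjc c *: adjmx A.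
Proof. by apply/matrixP => i j; rewrite !mxE rmorphM. Qed.

Lemma adjmx_sum n (I : Type) (r : seq I) (F : I -> 'M[C]_n) :
  adjmx (\sum_(i <- r) F i) = \sum_(i <- r) adjmx (F i).
Proof.
apply: (big_morph (@adjmx R n)) => [A B|]; apply/matrixP => i j.
  by rewrite !mxE rmorphD.
by rewrite !mxE rmorph0.
Qed.

Lemma adj_mode n j b : adjmx (mode n j b) = mode n j (~~ b).
Proof.
rewrite /mode adjmx_sum; apply: eq_bigr => t _.
by rewrite adjmxZ adj_ladder conj_fourier_c.
Qed.

Lemma calPE : calP L N eps =
  \sum_(n < N) \sum_(j < L) (omega N eps n)%:C *: (mode n j true *m mode n j false).
Proof.
rewrite /calP; apply: eq_bigr => n _; apply: eq_bigr => j _.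
by rewrite ahatE adj_mode.
Qed.

(** A unitary change of modes keeps the canonical relations: the double sum collapses to equal
    times, leaving row orthogonality. *)
Lemma mode_anticommutator (n m : 'I_N) (j l : 'I_L) b b' :
  mode n j b *m mode m l b' + mode m l b' *m mode n j b =
    [&& n == m, j == l & b != b']%:R%:M.
Proof.
have modeM (k k' : nat) i i' c c' : mode k i c *m mode k' i' c' =
    \sum_(t < N) \sum_(t' < N) (fourier_c k t (~~ c) * fourier_c k' t' (~~ c')) *:
       (ladder (L * N) (t * L + i) c *m ladder (L * N) (t' * L + i') c').
  rewrite /mode mulmx_suml; apply: eq_bigr => t _; rewrite mulmx_sumr.
  by apply: eq_bigr => t' _; rewrite -scalemxAl -scalemxAr scalerA.
rewrite !modeM [X in _ + X]exchange_big -big_split /=.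
have tE (t t' : 'I_N) : (t * L + j == t' * L + l)%N = (t == t') && (j == l).
  apply/eqP/andP => [h|[/eqP -> /eqP ->]] //.
  have L0 : (0 < L)%N by exact: leq_trans (ltn_ord j).
  have h1 : ((t * L + j) %/ L = (t' * L + l) %/ L)%N by rewrite h.
  move: h1; rewrite !divnMDl // !divn_small // !addn0 => h1.
  by move: h; rewrite h1 => /addnI h2; split; apply/eqP; apply: val_inj.
rewrite (eq_bigr (fun t : 'I_N => (fourier_c n t (~~ b) * fourier_c m t (~~ b')) *:
   ((j == l) && (b != b'))%:R%:M)) => [|t _]; last first.
  rewrite -big_split /= (bigD1 t) //= big1 => [|t' tt'].
    rewrite addr0 [X in _ + X *: _]mulrC -scalerDr ladder_anticommutator ?slice_mode //.
    by rewrite tE eqxx.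
  rewrite [X in _ + X *: _]mulrC -scalerDr ladder_anticommutator ?slice_mode //.
  by rewrite tE eq_sym (negPf tt') /= raddf0 scaler0.
rewrite -scaler_suml; case: (boolP ((j == l) && (b != b'))) => [/andP[jl bb']|h].
  rewrite andbT -fourier_orth_rows scale_scalar_mx mulr1; congr _%:M.
  case: b b' bb' => [] [] // _.
  rewrite -[LHS]conjcK -[RHS]conjcK; congr conjc; rewrite !rmorph_sum.
  have -> : \sum_(i < N) conjc (fourier n i * conjc (fourier m i)) = (n == m)%:R.
    by rewrite -rmorph_sum fourier_orth_rows; exact: conjc_nat.
  rewrite -fourier_orth_rows; apply: eq_bigr => t _.
  rewrite -[fourier n t]conjcK; exact: rmorphM.
by rewrite andbF raddf0 scaler0.
Qed.

Lemma calP_adj : adjmx (calP L N eps) = calP L N eps.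
Proof.
rewrite calPE adjmx_sum; apply: eq_bigr => n _; rewrite adjmx_sum; apply: eq_bigr => j _.
by rewrite adjmxZ conjc_real adjmxM !adj_mode.
Qed.

(** The commutator with the generator, put in intertwining form so that it can be exponentiated. *)
Lemma calP_mode_creation (n : 'I_N) (j : 'I_L) :
  calP L N eps *m mode n j true =
    mode n j true *m (calP L N eps + (omega N eps n)%:C%:M).
Proof.
rewrite mulmxDr mul_mx_scalar calPE mulmx_suml mulmx_sumr.
(* The extra term is spread over the double sum by Kronecker symbols, so that both sides can be
   compared term by term. *)
have -> : (omega N eps n)%:C *: mode n j true =
    \sum_(m < N) \sum_(l < L) ((n == m) && (j == l))%:R *: ((omega N eps m)%:C *: mode n j true).
  rewrite (bigD1 n) //= (bigD1 j) //= !eqxx scale1r big1 => [|l lj]; last first.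
    by rewrite eq_sym (negPf lj) scale0r.
  rewrite addr0 big1 ?addr0 // => m mn; rewrite big1 // => l _.
  by rewrite eq_sym (negPf mn) scale0r.
rewrite -big_split; apply: eq_bigr => m _; rewrite mulmx_suml mulmx_sumr -big_split /=.
apply: eq_bigr => l _; rewrite -scalemxAl -scalemxAr [_ *: (_ *: mode n j true)]scalerA.
rewrite [_%:R * _]mulrC -scalerA -scalerDr; congr (_ *: _).
have C1 : mode m l false *m mode n j true =
    [&& m == n, l == j & true]%:R%:M - mode n j true *m mode m l false.
  by rewrite -(mode_anticommutator m n l j false true) addrK.
have C2 : mode m l true *m mode n j true = - (mode n j true *m mode m l true).
  have := mode_anticommutator m n l j true true; rewrite !andbF raddf0 => /eqP.
  by rewrite addr_eq0 => /eqP.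
rewrite -(mulmxA (mode m l true)) C1 mulmxBr mul_mx_scalar (mulmxA (mode m l true)) C2.
rewrite mulNmx opprK [LHS]addrC mulmxA; congr (_ + _).
rewrite andbT (eq_sym m n) (eq_sym l j).
by case: andP => [[/eqP -> /eqP ->]|_] //; rewrite !scale0r.
Qed.

Lemma calP_mode (n : 'I_N) (j : 'I_L) b :
  calP L N eps *m mode n j b =
    mode n j b *m (calP L N eps + ((-1) ^+ (~~ b) * omega N eps n)%:C%:M).
Proof.
case: b; first by rewrite mul1r calP_mode_creation.
(* The annihilation case is the adjoint of the creation case, [calP] being hermitian. *)
have := congr1 (@adjmx R _) (calP_mode_creation n j).
rewrite !adjmxM calP_adj adj_mode /= => E.
have E' : mode n j false *m calP L N eps =
    calP L N eps *m mode n j false + (omega N eps n)%:C *: mode n j false.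
  rewrite E -mul_scalar_mx -mulmxDl; congr (_ *m _).
  apply/matrixP => i k; rewrite !mxE rmorphD rmorphMn /= oppr0.
  have /matrixP /(_ i k) := calP_adj; rewrite !mxE => ->.
  by rewrite eq_sym.
by rewrite mulmxDr mul_mx_scalar E' expr1 mulN1r rmorphN scaleNr addrK.
Qed.

Definition translation : 'M[C]_(2 ^ (L * N)) := expm (('i * eps%:C) *: calP L N eps).

Lemma translation_mode (n : 'I_N) (j : 'I_L) b :
  translation *m mode n j b = phase n b *: (mode n j b *m translation).
Proof.
rewrite scalemxAr /translation.
have -> : phase n b *: expm (('i * eps%:C) *: calP L N eps) =
   expm (('i * eps%:C) *: calP L N eps
           + ('i * ((-1) ^+ (~~ b) * (omega N eps n * eps))%:C)%:M).
  by rewrite expm_shift.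
apply: expm_intertwine; rewrite -scalemxAl calP_mode !mulmxDr scalerDr -scalemxAr.
congr (_ + _); rewrite !mul_mx_scalar scalerA; congr (_ *: _).
by rewrite -mulrA -rmorphM; congr (_ * _%:C); ring.
Qed.

Lemma ladder_modes (t : 'I_N) (j : 'I_L) b :
  ladder (L * N) (t * L + j) b = \sum_(n < N) fourier_c n t b *: mode n j b.
Proof.
under eq_bigr => n _ do rewrite /mode scaler_sumr.
rewrite exchange_big /= (bigD1 t) //= [X in _ = _ + X]big1 ?addr0.
  under eq_bigr => n _ do rewrite scalerA.
  rewrite -scaler_suml; have -> : \sum_(n < N) fourier_c n t b * fourier_c n t (~~ b) = (t == t)%:R.
    by rewrite -fourier_orth_cols; apply: eq_bigr => n _; case: b; rewrite // mulrC.
  by rewrite eqxx scale1r.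
move=> t' tt'; under eq_bigr => n _ do rewrite scalerA.
rewrite -scaler_suml.
have -> : \sum_(n < N) fourier_c n t b * fourier_c n t' (~~ b) = (t == t')%:R; last first.
  by rewrite eq_sym (negPf tt') scale0r.
case: b; last by rewrite -fourier_orth_cols.
by rewrite eq_sym -fourier_orth_cols; apply: eq_bigr => n _; rewrite mulrC.
Qed.

Lemma translation_ladder (t : 'I_N) (j : 'I_L) b :
  translation *m ladder (L * N) (t * L + j) b =
    (\sum_(n < N) fourier_c n t.+1 b *: mode n j b) *m translation.
Proof.
rewrite ladder_modes mulmx_sumr mulmx_suml; apply: eq_bigr => n _.
by rewrite fourier_cS [phase _ _ * _]mulrC -scalerA -!scalemxAl -scalemxAr translation_mode.
Qed.

Lemma translation_slice t (A : 'M[C]_(2 ^ L)) : (t.+1 < N)%N ->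
  translation *m slice N t A = slice N t.+1 A *m translation.
Proof.
move=> tN; have tN' := ltnW tN.
apply: (@slice_intertwine _ _ _ _ _ _ id) => // i b; rewrite !slice_ladder //.
rewrite (translation_ladder (Ordinal tN')) /=; congr (_ *m _).
by rewrite (ladder_modes (Ordinal tN)).
Qed.

(** On a generator the shift leads to the coefficients at time [N], which are minus those at time 0,
    and a sign on generators is the grading. *)
Lemma translation_last_slice (A : 'M[C]_(2 ^ L)) :
  translation *m slice N N.-1 A = slice N 0 (parity_conj A) *m translation.
Proof.
have tN : (N.-1 < N)%N by rewrite prednK.
apply: (@slice_intertwine _ _ _ _ _ _ (@parity_conj R L)) => //.
- exact: parity_conj1.
- exact: parity_conjD.
- exact: parity_conjZ.
- exact: parity_conjM.
move=> i b; rewrite parity_conj_ladder // -scaleN1r sliceZ // !slice_ladder //.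
rewrite (translation_ladder (Ordinal tN)) /= prednK // (ladder_modes (Ordinal N_gt0)).
rewrite scaler_sumr; congr (_ *m _); apply: eq_bigr => n _.
by rewrite fourier_cN scaleN1r scaleNr.
Qed.

Lemma translation_vacuum : translation *m ket (L * N) 0 = ket (L * N) 0.
Proof.
have M0 : (0 < 2 ^ (L * N))%N by rewrite expn_gt0.
(* All modes annihilate the vacuum, so [calP] acts there as the 1 by 1 zero matrix. *)
rewrite /translation (@expm_intertwine _ _ _ _ (0 : 'M[C]_1)).
  by rewrite expm0 -[1]/(1%:M) mulmx1.
rewrite mulmx0 -scalemxAl calPE mulmx_suml big1 ?scaler0 // => n _.
rewrite mulmx_suml big1 // => j _; rewrite -scalemxAl -mulmxA.
rewrite [X in _ *m X](_ : _ = 0) ?mulmx0 ?scaler0 //.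
rewrite /mode mulmx_suml big1 // => t _.
by rewrite -scalemxAl ladder_ket // occ0 scaler0.
Qed.

Lemma parity_conj_sum M (I : Type) (r : seq I) (F : I -> 'M[C]_(2 ^ M)) :
  parity_conj (\sum_(i <- r) F i) = \sum_(i <- r) parity_conj (F i).
Proof.
apply: (big_morph (@parity_conj R M)) => [A B|]; first exact: parity_conjD.
by rewrite /parity_conj mulmx0 mul0mx.
Qed.

Lemma parity_conj_calP : parity_conj (calP L N eps) = calP L N eps.
Proof.
have pm (n : nat) (j : 'I_L) b : parity_conj (mode n j b) = - mode n j b.
  rewrite /mode parity_conj_sum -sumrN; apply: eq_bigr => t _.
  by rewrite parity_conjZ parity_conj_ladder ?slice_mode // scalerN.
rewrite calPE parity_conj_sum; apply: eq_bigr => n _.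
rewrite parity_conj_sum; apply: eq_bigr => j _.
by rewrite parity_conjZ parity_conjM !pm mulNmx mulmxN opprK.
Qed.

Lemma comm_parity_conj M (A : 'M[C]_(2 ^ M)) :
  A *m parity R M = parity R M *m A -> parity_conj A = A.
Proof. by move=> E; rewrite /parity_conj -E -mulmxA parity_sqr mulmx1. Qed.

Lemma parity_conj_comm M (A : 'M[C]_(2 ^ M)) :
  parity_conj A = A -> A *m parity R M = parity R M *m A.
Proof. by move=> Ae; rewrite -{1}Ae /parity_conj -mulmxA parity_sqr mulmx1. Qed.

Lemma parity_conj_expm M (A : 'M[C]_(2 ^ M)) :
  parity_conj A = A -> parity_conj (expm A) = expm A.
Proof. by move/parity_conj_comm => E; apply/comm_parity_conj/expm_intertwine. Qed.

Lemma parity_conj_translation : parity_conj translation = translation.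
Proof. by apply: parity_conj_expm; rewrite parity_conjZ parity_conj_calP. Qed.

End Translation.

(** * Moving slice operators around the trace *)

Section TraceTransport.
Variable R : realType.
Local Notation C := R[i].
Local Notation ket := (ket R).
Variables (L N : nat).
Local Notation P := (parity R (L * N)).
Local Notation Hop := 'M[C]_(2 ^ (L * N)).
Local Notation hop := 'M[C]_(2 ^ L).

(* Otherwise failing unifications unfold the exponential series. *)
Local Opaque slice parity translation expm.

Lemma parity_comm M (A : 'M[C]_(2 ^ M)) : A *m parity R M = parity R M *m parity_conj A.
Proof. by rewrite /parity_conj !mulmxA parity_sqr mul1mx. Qed.

Lemma mxtrace_sandwichD n (X Y A B : 'M[C]_n) :
  \tr (X *m ((A + B) *m Y)) = \tr (X *m (A *m Y)) + \tr (X *m (B *m Y)).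
Proof. by rewrite mulmxDl mulmxDr mxtraceD. Qed.

Lemma mxtrace_rotate n (X A B : 'M[C]_n) : \tr (X *m (A *m B)) = \tr (B *m X *m A).
Proof. by rewrite mulmxA mxtrace_mulC mulmxA. Qed.

Lemma mulmx_exchange n (B B' B'' X Y A : 'M[C]_n) : B *m X = X *m B' ->
  B' *m Y = Y *m B'' -> B *m (X *m Y) *m A = X *m Y *m (B'' *m A).
Proof. by move=> h1 h2; rewrite !mulmxA h1 -(mulmxA X) h2 !mulmxA. Qed.

Lemma even_partE (A : hop) : even_part A = 2^-1 *: (A + parity_conj A).
Proof. by rewrite /even_part invmx_parity. Qed.

Lemma odd_partE (A : hop) : odd_part A = 2^-1 *: (A - parity_conj A).
Proof. by rewrite /odd_part invmx_parity. Qed.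

Lemma parity_conjN M (A : 'M[C]_(2 ^ M)) : parity_conj (- A) = - parity_conj A.
Proof. by rewrite -scaleN1r parity_conjZ scaleN1r. Qed.

Lemma parity_conj_par_part b (A : hop) : parity_conj (par_part b A) = (-1) ^+ b *: par_part b A.
Proof.
case: b; rewrite /par_part ?odd_partE ?even_partE parity_conjZ parity_conjD ?parity_conjN parity_conjK.
  by rewrite expr1 scaleN1r -scalerN opprB addrC.
by rewrite expr0 scale1r addrC.
Qed.

Lemma even_add_odd (A : hop) : A = \sum_(b : bool) par_part b A.
Proof.
rewrite big_bool /= odd_partE even_partE -scalerDr addrC addrACA subrr addr0.
by rewrite -mulr2n -scalerMnr scalerMnl -mulr_natr mulVf ?scale1r // pnatr_eq0.
Qed.

(* [Y] behaves, with respect to slice [t], like an operator supported on the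
   other slices. *)
Definition spectator t (Y : Hop) := forall A : hop,
  (parity_conj A = A -> Y *m slice N t A = slice N t A *m Y) /\
  (parity_conj A = - A -> parity_conj Y *m slice N t A = slice N t A *m Y).

Lemma spectator1 t : spectator t 1%:M.
Proof. by move=> A; rewrite parity_conj1 mul1mx mulmx1. Qed.

Lemma spectatorM t Y Z : spectator t Y -> spectator t Z -> spectator t (Y *m Z).
Proof.
move=> SY SZ A; have [Y0 Y1] := SY A; have [Z0 Z1] := SZ A; split=> h.
  by rewrite -mulmxA Z0 // !mulmxA Y0.
by rewrite parity_conjM -mulmxA Z1 // !mulmxA Y1.
Qed.

Lemma spectator_slice t t' B : (t < N)%N -> (t' < N)%N -> t != t' ->
  spectator t (slice N t' B).
Proof.
move=> tN t'N tt' A; split=> h; first exact: slice_even_comm.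
by rewrite parity_conj_slice // slice_odd_comm.
Qed.

Lemma spectator_prod t (I : eqType) (s : seq I) (T : I -> nat) (B : I -> hop) :
  (t < N)%N -> (forall i, i \in s -> (T i < N)%N && (t != T i)) ->
  spectator t (\prod_(i <- s) slice N (T i) (B i)).
Proof.
move=> tN H; rewrite big_seq; apply: big_ind => [||i /H /andP[]].
- exact: spectator1.
- exact: spectatorM.
- by move=> *; exact: spectator_slice.
Qed.

Lemma slice_sign_comm t t' (b b' : bool) (A B : hop) : (t < N)%N -> (t' < N)%N -> t != t' ->
  parity_conj A = (-1) ^+ b *: A -> parity_conj B = (-1) ^+ b' *: B ->
  slice N t A *m slice N t' B = (-1) ^+ (b && b') *: (slice N t' B *m slice N t A).
Proof.
move=> tN t'N tt'; case: b => hA; last first.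
  by move=> _; rewrite expr0 scale1r; symmetry; apply: slice_even_comm; rewrite // hA scale1r.
case: b' => hB; last first.
  by rewrite expr0 scale1r; apply: slice_even_comm; rewrite 1?eq_sym // hB scale1r.
rewrite expr1 scaleN1r in hA hB *.
by rewrite -slice_odd_comm // hB -scaleN1r sliceZ // -scalemxAl scaleN1r.
Qed.

(** * Transport for an abstract even shift [E], used for the full evolution and for the bare
    translation *)

Section Transport.
Variables (E : Hop) (V Vi : hop).
Hypotheses (VVi : V *m Vi = 1%:M) (ViV : Vi *m V = 1%:M).
Hypothesis E_shift : forall t A, (t.+1 < N)%N ->
  E *m slice N t A = slice N t.+1 (V *m A *m Vi) *m E.
Hypothesis E_even : parity_conj E = E.

(* Cyclicity brings the slice [t + 1] operator to the left of [E]; for an odd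
   operator the sign from crossing [P] cancels the one from crossing [Y]. *)
Lemma trace_move t A Y : (t.+1 < N)%N -> spectator t.+1 Y ->
  \tr (P *m E *m (slice N t.+1 A *m Y)) = \tr (P *m E *m (slice N t (Vi *m A *m V) *m Y)).
Proof.
move=> tN SY; have tN' := ltnW tN.
have shift B : slice N t.+1 B *m E = E *m slice N t (Vi *m B *m V).
  by rewrite E_shift // !mulmxA VVi mul1mx -mulmxA VVi mulmx1.
have K b : \tr (P *m E *m (slice N t.+1 (par_part b A) *m Y)) =
    \tr (P *m E *m (slice N t (Vi *m par_part b A *m V) *m Y)).
  have := parity_conj_par_part b A; set B := par_part b A => hB.
  have [S0 S1] := SY B; case: b @B hB S0 S1 => B; rewrite ?expr1 ?expr0 ?scaleN1r ?scale1r => hB S0 S1.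
    rewrite -S1 // mulmxA mxtrace_mulC /parity_conj !mulmxA mxtrace_mulC.
    rewrite -[_ *m P *m Y](mulmxA _ P Y) -!mulmxA.
    rewrite (mulmxA P E) (mulmxA (P *m E)) -/(parity_conj E) E_even.
    by rewrite (mulmxA (slice N t.+1 B) E) shift -!mulmxA.
  rewrite -S0 // mulmxA mxtrace_mulC !mulmxA.
  have -> : slice N t.+1 B *m P = P *m slice N t.+1 B.
    by rewrite parity_comm parity_conj_slice // hB.
  by rewrite -(mulmxA P (slice N t.+1 B) E) shift !mulmxA.
have AE : A = par_part true A + par_part false A by rewrite {1}[A]even_add_odd big_bool.
(* Occurrences 5 and 6 of [A] are those of the goal; the first four sit inside the parity components
   and must stay. *)
move: (K true) (K false); rewrite {5 6}AE.
move: (par_part true A) (par_part false A) => A1 A0 K1 K0.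
have -> : Vi *m (A1 + A0) *m V = Vi *m A1 *m V + Vi *m A0 *m V.
  by rewrite mulmxDr mulmxDl.
rewrite (sliceD A1 A0 tN) (sliceD (Vi *m A1 *m V) (Vi *m A0 *m V) tN').
apply: etrans (mxtrace_sandwichD _ _ _ _) _.
apply: etrans _ (esym (mxtrace_sandwichD _ _ _ _)).
have add_eq (a b c d : C) : a = c -> b = d -> a + b = c + d by move=> -> ->.
by apply: add_eq; [exact: K1 | exact: K0].
Qed.

(** Discrete Heisenberg evolution, in powers because [V] is here only an invertible matrix. *)
Definition heis_step t (A : hop) : hop := Vi ^+ t *m A *m V ^+ t.

Lemma heis_step0 A : heis_step 0 A = A.
Proof. by rewrite /heis_step !expr0 -[1]/(1%:M) mul1mx mulmx1. Qed.

Lemma heis_stepD s t A : heis_step s (heis_step t A) = heis_step (s + t) A.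
Proof.
have Vts : V ^+ (s + t) = V ^+ t *m V ^+ s by rewrite addnC exprD.
have Vist : Vi ^+ (s + t) = Vi ^+ s *m Vi ^+ t by rewrite exprD.
by rewrite /heis_step Vts Vist !mulmxA.
Qed.

Lemma heis_step1 t : heis_step t 1%:M = 1%:M.
Proof.
elim: t => [|t IH]; first by rewrite heis_step0.
by rewrite -[t.+1]addn1 -heis_stepD -[RHS]IH {2}/heis_step !expr1 mulmx1 ViV.
Qed.

Lemma mulVVi t : V ^+ t *m Vi ^+ t = 1%:M.
Proof.
elim: t => [|t IH]; first by rewrite !expr0 -[1]/(1%:M) mul1mx.
rewrite exprS exprSr -[V * _]/(V *m _) -[_ * Vi]/(_ *m Vi) -mulmxA (mulmxA (V ^+ t)) IH.
by rewrite mul1mx.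
Qed.

Lemma heis_stepM t A B : heis_step t (A *m B) = heis_step t A *m heis_step t B.
Proof.
by rewrite /heis_step !mulmxA -(mulmxA _ (V ^+ t) (Vi ^+ t)) mulVVi mulmx1.
Qed.

Lemma trace_move_down t d A Y : (t + d < N)%N ->
  (forall t', (t < t' <= t + d)%N -> spectator t' Y) ->
  \tr (P *m E *m (slice N (t + d) A *m Y)) =
    \tr (P *m E *m (slice N t (heis_step d A) *m Y)).
Proof.
elim: d A => [|d IH] A; first by rewrite addn0 heis_step0.
rewrite addnS => tdN SY.
have S1 : spectator (t + d).+1 Y by apply: SY; rewrite leqnn andbT; lia.
have S' t' : (t < t' <= t + d)%N -> spectator t' Y.
  by move=> /andP[h1 h2]; apply: SY; rewrite h1 leqW.
have HA : heis_step d (Vi *m A *m V) = heis_step d.+1 A.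
  by rewrite -(addn1 d) -heis_stepD /heis_step !expr1.
by rewrite (trace_move A tdN S1) (IH _ (ltnW tdN) S') HA.
Qed.

(** [A] accumulates the factors already collapsed: it descends to the slice of the next factor,
    merges with it there and goes on. Sortedness keeps the rest of the word strictly below each
    slice being left, so the rest is a spectator. *)
Lemma trace_sorted_word (I : eqType) (s : seq I) (T : I -> nat) (B : I -> hop) t A :
  (t < N)%N -> path (fun a b => (b <= a)%N) t [seq T i | i <- s] ->
  \tr (P *m E *m (slice N t A *m \prod_(i <- s) slice N (T i) (B i))) =
  \tr (P *m E *m slice N 0 (heis_step t A *m \prod_(i <- s) heis_step (T i) (B i))).
Proof.
elim: s t A => [|j s IH] t A tN /=.
  move=> _; rewrite !big_nil -![1]/(1%:M) mulmx1.
  have tN0 : (0 + t < N)%N by rewrite add0n.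
  have S0 t' : (0 < t' <= 0 + t)%N -> spectator t' 1%:M by move=> _; exact: spectator1.
  by have := trace_move_down A tN0 S0; rewrite add0n !mulmx1.
move=> /andP[jt srt]; have jN : (T j < N)%N by exact: leq_ltn_trans jt tN.
have le_j i : i \in s -> (T i <= T j)%N.
  have tr : transitive (fun a b => (b <= a)%N) by move=> a b c h1 h2; exact: leq_trans h2 h1.
  move=> is_; move: srt; rewrite (path_sortedE tr) => /andP[/allP h _].
  by apply: (h (T i)); exact: map_f.
set Y := \prod_(i <- s) slice N (T i) (B i).
set Z := \prod_(i <- s) heis_step (T i) (B i).
have SY t' : (T j < t' <= T j + (t - T j))%N -> spectator t' (slice N (T j) (B j) *m Y).
  rewrite subnKC // => /andP[jt' t't].
  have t'N : (t' < N)%N by exact: leq_ltn_trans t't tN.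
  apply: spectatorM; first by apply: spectator_slice => //; lia.
  apply: spectator_prod => // i is_; have := le_j i is_; lia.
have tN' : (T j + (t - T j) < N)%N by rewrite subnKC.
rewrite !big_cons -/Y -/Z -[_ * Y]/(_ *m Y) -[_ * Z]/(_ *m Z).
have := trace_move_down A tN' SY; rewrite subnKC // => ->.
have ABE : slice N (T j) (heis_step (t - T j) A) *m (slice N (T j) (B j) *m Y) =
    slice N (T j) (heis_step (t - T j) A *m B j) *m Y.
  by rewrite mulmxA -(sliceM _ _ jN).
rewrite ABE (IH _ _ jN srt) -/Z heis_stepM heis_stepD subnKC //.
by rewrite mulmxA.
Qed.

End Transport.

Lemma slice_prod_comm (V : hop) t (s : seq nat) A :
  parity_conj V = V -> (t < N)%N -> (forall u, u \in s -> (u < N)%N && (t != u)) ->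
  (\prod_(u <- s) slice N u V) *m slice N t A = slice N t A *m \prod_(u <- s) slice N u V.
Proof.
move=> Ve tN; elim: s => [|u s IH] H.
  by rewrite big_nil -[1]/(1%:M) mul1mx mulmx1.
have /andP[uN tu] := H u (mem_head _ _).
rewrite big_cons -[_ * _]/(_ *m _) -mulmxA IH => [|v vs]; last first.
  by apply: H; rewrite inE vs orbT.
by rewrite !mulmxA (slice_even_comm A uN tN) // eq_sym.
Qed.

Definition slices_below (V : hop) n : Hop := \prod_(u < n) slice N u V.

Lemma slices_belowE V n : slices_below V n = \prod_(u <- iota 0 n) slice N u V.
Proof. by rewrite /slices_below -(big_mkord xpredT (fun u => slice N u V)) /index_iota subn0. Qed.

(** The product is defined with increasing slices but consumed from the top; even [V] allows the
    reversal because its slices commute. *)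
Lemma slices_belowS V n : parity_conj V = V -> (n < N)%N ->
  slices_below V n.+1 = slice N n V *m slices_below V n.
Proof.
move=> Ve nN; rewrite {1}/slices_below big_ord_recr /= -[_ * _]/(slices_below V n *m _).
rewrite slices_belowE slice_prod_comm // => u; rewrite mem_iota add0n /= => un.
by rewrite (ltn_trans un nN) neq_ltn un orbT.
Qed.

Lemma spectator_slices_below V n t : (t < N)%N -> (n <= t)%N ->
  spectator t (slices_below V n).
Proof.
move=> tN nt; rewrite slices_belowE.
apply: (@spectator_prod t _ _ id (fun=> V)) => // u; rewrite mem_iota add0n /= => un.
by rewrite !(ltn_trans _ tN) ?neq_ltn ?(leq_trans un nt) ?orbT.
Qed.

End TraceTransport.

(** * The trace induced on slice 0, and time-ordered words *)

Section TraceFormula.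
Variable R : realType.
Local Notation C := R[i].
Local Notation ket := (ket R).
Variables (L N : nat).
Local Notation P := (parity R (L * N)).
Local Notation Hop := 'M[C]_(2 ^ (L * N)).
Local Notation hop := 'M[C]_(2 ^ L).
Local Notation slices_below := (slices_below N).

Local Opaque slice parity translation expm.

Lemma mulmx_through n (p1 v p2 a x : 'M[C]_n) : p2 *m a = a *m p2 ->
  x *m p1 = p1 *m x -> x *m v = v *m a -> p1 *m (v *m p2) *m a = x *m (p1 *m (v *m p2)).
Proof.
by move=> h2 h1 hv; rewrite -!mulmxA h2 !mulmxA h1 -(mulmxA p1 x) hv !mulmxA.
Qed.

Variable eps : R.
Hypotheses (N_gt0 : (0 < N)%N) (eps_gt0 : 0 < eps).
Local Notation U := (translation L N eps).

Let U_shift t A : (t.+1 < N)%N ->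
  U *m slice N t A = slice N t.+1 (1%:M *m A *m (1%:M : hop)) *m U.
Proof. by move=> tN; rewrite mul1mx mulmx1 translation_slice. Qed.

Let U_even : parity_conj U = U.
Proof. exact: parity_conj_translation. Qed.

Let one_one : (1%:M : hop) *m 1%:M = 1%:M.
Proof. exact: mul1mx. Qed.

(** While descending from slice [n], [A] absorbs one [V] on each slice below; [Q] waits on slice
    0. *)
Lemma trace_slices_below V A Q n : parity_conj V = V -> (n < N)%N ->
  \tr (P *m U *m (slice N n A *m (slices_below V n *m slice N 0 Q))) =
  \tr (P *m U *m slice N 0 (A *m V ^+ n *m Q)).
Proof.
move=> Ve; elim: n A => [|n IH] A nN.
  rewrite /slices_below big_ord0 expr0 -![1]/(1%:M) mul1mx mulmx1.
  by rewrite sliceM.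
rewrite (trace_move one_one U_shift U_even) //; last first.
  apply: spectatorM; first exact: spectator_slices_below.
  exact: spectator_slice.
rewrite mul1mx mulmx1 slices_belowS ?(ltnW nN) // -(mulmxA (slice N n V)).
rewrite (mulmxA (slice N n A)) -sliceM ?(ltnW nN) // IH ?(ltnW nN) //.
by rewrite exprS -[V * _]/(V *m _) !mulmxA.
Qed.

Lemma trace_all_slices V Q : parity_conj V = V ->
  \tr (P *m U *m (slices_below V N *m slice N 0 Q)) =
  \tr (P *m U *m slice N 0 (V ^+ N *m Q)).
Proof.
move=> Ve; have lastN : (N.-1 < N)%N by rewrite prednK.
have := slices_belowS Ve lastN; rewrite prednK // => ->.
by rewrite -(mulmxA (slice N N.-1 V)) (trace_slices_below _ _ Ve lastN) -[V *m _]/(V * _) -exprS prednK.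
Qed.

(** [B] goes once around: crossing [P] grades it, crossing [U] sends it to the last slice and
    removes the grading, and the bare translation brings it down to the left of [A]. *)
Lemma trace_slice0_comm A B :
  \tr (P *m U *m slice N 0 (A *m B)) = \tr (P *m U *m slice N 0 (B *m A)).
Proof.
have lastN : (0 + N.-1 < N)%N by rewrite add0n prednK.
have bP : slice N 0 B *m P = P *m slice N 0 (parity_conj B).
  by rewrite -(parity_conj_slice B N_gt0); exact: parity_comm.
have bU : slice N 0 (parity_conj B) *m U = U *m slice N (0 + N.-1) B.
  by apply/esym; rewrite add0n; exact: translation_last_slice.
have S0 t' : (0 < t' <= 0 + N.-1)%N -> spectator t' (slice N 0 A).
  move=> /andP[t0 t'N]; have t'N' : (t' < N)%N by exact: leq_ltn_trans t'N lastN.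
  by apply: spectator_slice => //; rewrite neq_ltn t0 orbT.
have hB : heis_step 1%:M 1%:M N.-1 B = B.
  by rewrite /heis_step !expr1n -[1]/(1%:M) mul1mx mulmx1.
rewrite (sliceM A B N_gt0) (sliceM B A N_gt0).
apply: etrans (mxtrace_rotate _ _ _) _; rewrite (mulmx_exchange _ bP bU).
by apply: etrans (trace_move_down one_one U_shift U_even B lastN S0) _; rewrite hB.
Qed.

Lemma slices_below_vacuum : slices_below (outer R L 0 0) N = outer R (L * N) 0 0.
Proof.
have M0 : (0 < 2 ^ (L * N))%N by rewrite expn_gt0.
apply: ket_ext => x xM; rewrite outer_ket //.
have H n : (n <= N)%N -> slices_below (outer R L 0 0) n *m ket (L * N) x =
    [forall u : 'I_n, bits_get (u * L) L x == 0%N]%:R *: ket (L * N) x.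
  move=> nN; rewrite slices_belowE.
  have -> : [forall u : 'I_n, bits_get (u * L) L x == 0%N] =
      all (fun u => bits_get (u * L) L x == 0%N) (iota 0 n).
    apply/forallP/allP => [h u|h u]; last by apply: h; rewrite mem_iota add0n ltn_ord.
    by rewrite mem_iota add0n /= => un; exact: (h (Ordinal un)).
  have : all (fun u => (u < N)%N) (iota 0 n).
    by apply/allP => u; rewrite mem_iota add0n /= => un; exact: leq_trans un nN.
  elim: (iota 0 n) => [|u s IH] /=; first by rewrite big_nil -[1]/(1%:M) mul1mx scale1r.
  move=> /andP[uN sN]; rewrite big_cons -[_ * _]/(_ *m _) -mulmxA IH // -scalemxAr.
  by rewrite slice_vacuum_ket // scalerA -natrM mulnb andbC.
rewrite H //; case: eqP => [<-|x0].
  rewrite (_ : [forall _, _]) ?scale1r //; apply/forallP => u.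
  by rewrite /bits_get div0n mod0n.
case: (exists_occ xM) => [|m mM om]; first by rewrite lt0n; apply/eqP => h; apply: x0.
have L0 : (0 < L)%N by case: (posnP L) mM => // ->.
have uN : (m %/ L < N)%N by rewrite ltn_divLR // mulnC.
case: forallP => [h|_]; last by rewrite !scale0r.
have := occ_get (m %/ L * L) L x (m %% L).
by rewrite (eqP (h (Ordinal uN))) occ0 -divn_eq om ltn_mod L0.
Qed.

Lemma parity_conj_vacuum : parity_conj (outer R L 0 0) = outer R L 0 0.
Proof.
have Z0 : (0 < 2 ^ L)%N by rewrite expn_gt0.
have s0 : occ_sign R L 0 = 1 by rewrite /occ_sign big1 // => j _; rewrite occ0.
have p0 : parity R L *m outer R L 0 0 = outer R L 0 0.
  by rewrite /outer mulmxA parity_ket // s0 scale1r.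
rewrite /parity_conj p0; apply: ket_ext => z zL.
rewrite -mulmxA parity_ket // -scalemxAr outer_ket //.
by case: eqP => [<-|_]; rewrite ?s0 ?scale1r // !scale0r scaler0.
Qed.

Lemma outer_idem n : (0 < n)%N -> outer R L 0 0 ^+ n = outer R L 0 0.
Proof.
case: n => // n _; elim: n => [|n IH]; first by rewrite expr1.
by rewrite exprS IH -[_ * _]/(_ *m _) outerM ?expn_gt0 // eqxx scale1r.
Qed.

(** [trace_all_slices] is read backwards with the vacuum projector for [V] and the identity for [Q]:
    by idempotence one copy on slice 0 may be replaced by a copy on every slice. *)
Lemma trace_vacuum : \tr (P *m U *m slice N 0 (outer R L 0 0)) = 1.
Proof.
have M0 : (0 < 2 ^ (L * N))%N by rewrite expn_gt0.
have s0 : occ_sign R (L * N) 0 = 1 by rewrite /occ_sign big1 // => j _; rewrite occ0.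
have PU0 : P *m U *m ket (L * N) 0 = ket (L * N) 0.
  apply: etrans (esym (mulmxA P U _)) _.
  have UE := translation_vacuum L N eps.
  have PE := parity_ket R M0.
  apply: etrans (congr1 (mulmx P) UE) _.
  apply: etrans PE _.
  by rewrite s0 scale1r.
have H := trace_all_slices 1%:M parity_conj_vacuum.
rewrite (slice1 R L N_gt0) !mulmx1 (outer_idem N_gt0) slices_below_vacuum in H.
apply: etrans (esym H) _.
rewrite /outer (mulmxA (P *m U)) PU0 mxtrace_mulC (ket_dot R M0 M0).
by rewrite eqxx mxtrace1.
Qed.

Lemma trace_slice0 A : \tr (P *m U *m slice N 0 A) = \tr A.
Proof.
pose f B := \tr (P *m U *m slice N 0 B).
have fD : {morph f : B D / B + D} by move=> B D; rewrite /f (sliceD B D N_gt0) mulmxDr mxtraceD.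
have fZ c B : f (c *: B) = c * f B by rewrite /f (sliceZ c B N_gt0) -scalemxAr mxtraceZ.
have f0 : f 0 = 0 by rewrite -(scale0r 0) fZ mul0r.
rewrite -/(f A) {1}[A]matrix_sum_delta (big_morph f fD f0) /mxtrace; apply: eq_bigr => i _.
rewrite (big_morph f fD f0).
have fd j : f (A i j *: delta_mx i j) = (i == j)%:R * A i j.
  rewrite fZ mulrC -outer_delta -[outer R L i j]scale1r.
  (* A matrix unit is factored through the vacuum; exchanging the factors leaves a Kronecker symbol
     times the vacuum projector. *)
  have -> : 1 *: outer R L i j = outer R L i 0 *m outer R L 0 j.
    by rewrite outerM ?expn_gt0.
  have Z0 : (0 < 2 ^ L)%N by rewrite expn_gt0.
  have -> : f (outer R L i 0 *m outer R L 0 j) = f (outer R L 0 j *m outer R L i 0).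
    exact: trace_slice0_comm.
  rewrite outerM // fZ (trace_vacuum : f _ = 1) mulr1.
  by rewrite eq_sym.
rewrite (bigD1 i) //= fd eqxx mul1r big1 ?addr0 // => j ji.
by rewrite fd eq_sym (negPf ji) mul0r.
Qed.

Section TimeOrdering.
Variables (V Vi : hop).
Hypotheses (VVi : V *m Vi = 1%:M) (ViV : Vi *m V = 1%:M) (V_even : parity_conj V = V).

(** Even factors on other slices commute with [slice N t A], so only the factor on slice [t]
    conjugates it before the translation moves it on. *)
Lemma slices_shift t A : (t.+1 < N)%N ->
  U *m slices_below V N *m slice N t A =
    slice N t.+1 (V *m A *m Vi) *m (U *m slices_below V N).
Proof.
move=> tN; have tN' := ltnW tN.
have K : slices_below V N *m slice N t A = slice N t (V *m A *m Vi) *m slices_below V N.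
  rewrite slices_belowE; have := iota_uniq 0 N; have : t \in iota 0 N by rewrite mem_iota.
  have : forall u, u \in iota 0 N -> (u < N)%N by move=> u; rewrite mem_iota.
  move: (iota 0 N) => s sN /splitPr ts; case: ts sN => s1 s2 sN.
  rewrite cat_uniq /= => /and3P[_ /norP[t1 _] /andP[t2 _]].
  have cond s' : t \notin s' -> {subset s' <= s1 ++ t :: s2} ->
      forall u, u \in s' -> (u < N)%N && (t != u).
    by move=> ts' sub u us; rewrite (sN _ (sub _ us)); apply: contraNneq ts' => ->.
  have c1 B : slice N t B *m \prod_(u <- s1) slice N u V =
      \prod_(u <- s1) slice N u V *m slice N t B.
    have sub1 : {subset s1 <= s1 ++ t :: s2} by move=> u us; rewrite mem_cat us.
    symmetry; apply: (slice_prod_comm B V_even tN'); exact: cond s1 t1 sub1.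
  have c2 : \prod_(u <- s2) slice N u V *m slice N t A =
      slice N t A *m \prod_(u <- s2) slice N u V.
    have sub2 : {subset s2 <= s1 ++ t :: s2}.
      by move=> u us; rewrite mem_cat inE us !orbT.
    by apply: (slice_prod_comm A V_even tN'); exact: cond s2 t2 sub2.
  have xv : slice N t (V *m A *m Vi) *m slice N t V = slice N t V *m slice N t A.
    by rewrite -(sliceM _ _ tN') -(sliceM V A tN') -mulmxA ViV mulmx1.
  have -> : \prod_(u <- s1 ++ t :: s2) slice N u V =
      \prod_(u <- s1) slice N u V *m (slice N t V *m \prod_(u <- s2) slice N u V).
    by rewrite big_cat big_cons.
  exact: mulmx_through c2 (c1 _) xv.
by rewrite -(mulmxA U) K mulmxA translation_slice // -mulmxA.
Qed.

Lemma parity_conj_slices n : (n <= N)%N -> parity_conj (slices_below V n) = slices_below V n.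
Proof.
elim: n => [|n IH] nN; first by rewrite /slices_below big_ord0 -[1]/(1%:M) parity_conj1.
by rewrite slices_belowS // parity_conjM IH ?(ltnW nN) // parity_conj_slice // V_even.
Qed.

Lemma trace_time_ordered (I : eqType) (s : seq I) (T : I -> nat) (B : I -> hop) :
  (forall i, i \in s -> (T i < N)%N) -> sorted (fun i j => (T j <= T i)%N) s ->
  \tr (P *m (U *m slices_below V N) *m \prod_(i <- s) slice N (T i) (B i)) =
  \tr (V ^+ N *m \prod_(i <- s) heis_step V Vi (T i) (B i)).
Proof.
move=> sN srt; have lastN : (N.-1 < N)%N by rewrite prednK.
have E_even : parity_conj (U *m slices_below V N) = U *m slices_below V N.
  by rewrite parity_conjM U_even parity_conj_slices.
have hs1 : heis_step V Vi N.-1 1%:M = 1%:M by apply: heis_step1.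
have tr : transitive (fun a b => (b <= a)%N) by move=> a b c h1 h2; exact: leq_trans h2 h1.
have pth : path (fun a b => (b <= a)%N) N.-1 [seq T i | i <- s].
  rewrite (path_sortedE tr) sorted_map srt andbT; apply/allP => _ /mapP[i is_ ->].
  by rewrite -ltnS prednK // sN.
(* The accumulator starts as the identity on the last slice, which bounds all times from above. *)
have W := trace_sorted_word VVi slices_shift E_even B 1%:M lastN pth.
rewrite (slice1 R L lastN) hs1 !mul1mx in W.
apply: etrans W _; apply: etrans _ (trace_slice0 _).
apply: etrans _ (trace_all_slices _ V_even).
by rewrite !mulmxA.
Qed.

End TimeOrdering.

End TraceFormula.

(** * Stability of the time sort and the sign in the time ordering *)

Section TimeSort.
Variable R : realType.
Local Notation C := R[i].

Lemma tsort_perm k (s : 'I_k -> R) : perm_eq (tsort s) (enum 'I_k).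
Proof. by rewrite perm_sort. Qed.

Lemma mem_tsort k (s : 'I_k -> R) i : i \in tsort s.
Proof. by rewrite (perm_mem (tsort_perm s)) mem_enum. Qed.

Lemma tsort_uniq k (s : 'I_k -> R) : uniq (tsort s).
Proof. by rewrite (perm_uniq (tsort_perm s)) enum_uniq. Qed.

Lemma index_enum_ord k : index_enum 'I_k = enum 'I_k.
Proof. by rewrite [index_enum _]unlock enumT. Qed.

Lemma sorted_enum_ord k : sorted (fun p q : 'I_k => (p < q)%N) (enum 'I_k).
Proof.
have := iota_ltn_sorted 0 k; rewrite -val_enum_ord sorted_map.
by [].
Qed.

(** For [p < q] the second clause excludes equal labels: stability means that only factors at
    different times are ever exchanged. *)
Lemma tsort_stable k (s : 'I_k -> R) (p q : 'I_k) :
  (index q (tsort s) < index p (tsort s))%N ->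
  s p <= s q /\ (s q <= s p -> (q < p)%N).
Proof.
pose leT (i j : 'I_k) := s j <= s i.
have tot : total leT by move=> i j; exact: le_total.
have trs : transitive (fun p q : 'I_k => (p < q)%N) by move=> ? ? ?; exact: ltn_trans.
pose r := [rel x y : 'I_k | leT x y && (leT y x ==> (x < y)%N)].
have srt : sorted r (tsort s) := sort_stable tot trs (sorted_enum_ord k).
have r_tr : transitive r.
  move=> y x z /= /andP[xy yx] /andP[yz zy]; rewrite /leT in xy yx yz zy *.
  rewrite (le_trans yz xy) /=; apply/implyP => zx.
  have h1 : s x <= s y by exact: le_trans zx yz.
  have h2 : s y <= s z by exact: le_trans xy zx.
  rewrite h1 in yx; rewrite h2 in zy; exact: ltn_trans yx zy.
move=> lt_qp; have := sorted_ltn_index r_tr srt q p (mem_tsort s q) (mem_tsort s p) lt_qp.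
by rewrite /= /leT => /andP[h1 /implyP h2].
Qed.

Lemma tsort_sorted k (s : 'I_k -> R) : sorted (fun i j => s j <= s i) (tsort s).
Proof. by apply: sort_sorted => i j; exact: le_total. Qed.

Lemma prod_tsort_sign n k (s : 'I_k -> R) (par : pred 'I_k) (X : 'I_k -> 'M[C]_n) :
  (forall p q, s p != s q -> X p * X q = (-1) ^+ (par p && par q) *: (X q * X p)) ->
  \prod_(l < k) X l = Tdef s X par.
Proof.
move=> H; rewrite /Tdef.
have -> : [set p : 'I_k * 'I_k | [&& (p.1 < p.2)%N, par p.1, par p.2 &
      (index p.2 (tsort s) < index p.1 (tsort s))%N]] =
    inversions (tsort s) (fun p q : 'I_k => (p < q)%N) par.
  by apply/setP => -[p q]; rewrite !inE !mem_tsort.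
have E : \prod_(q <- index_enum 'I_k | q \in tsort s) X q =
    (-1) ^+ #|inversions (tsort s) (fun p q : 'I_k => (p < q)%N) par| *:
      \prod_(q <- tsort s) X q.
  apply: prod_sort_sign.
  - by move=> p; exact: ltnn.
  - by move=> ? ? ?; exact: ltn_trans.
  - by rewrite index_enum_ord; exact: sorted_enum_ord.
  - exact: tsort_uniq.
  - by move=> p _; exact: mem_index_enum.
  - move=> p q _ _ pq /tsort_stable[h1 h2]; apply: H.
    by apply/negP => /eqP spq; move: h2; rewrite spq lexx => /(_ isT); rewrite ltnNge ltnW.
by rewrite -E; apply: eq_bigl => i; rewrite mem_tsort.
Qed.

Variables (L : nat) (V Vi : 'M[C]_(2 ^ L)).
Hypotheses (V_even : parity_conj V = V) (Vi_even : parity_conj Vi = Vi).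

Lemma parity_conjX (A : 'M[C]_(2 ^ L)) t : parity_conj A = A -> parity_conj (A ^+ t) = A ^+ t.
Proof.
move=> Ae; elim: t => [|t IH]; first exact: parity_conj1.
by rewrite exprS -[A * _]/(A *m _) parity_conjM Ae IH.
Qed.

(** The slice word is split by parity before the evolution, the time-ordered product after it;
    evenness of [V] and [Vi] reconciles the two. *)
Lemma heis_step_par_part t b A :
  heis_step V Vi t (par_part b A) = par_part b (heis_step V Vi t A).
Proof.
have E : parity_conj (heis_step V Vi t A) = heis_step V Vi t (parity_conj A).
  by rewrite /heis_step !parity_conjM !parity_conjX.
case: b; rewrite /par_part ?odd_partE ?even_partE E /heis_step.
  by rewrite -scalemxAr -scalemxAl mulmxBr mulmxBl.
by rewrite -scalemxAr -scalemxAl mulmxDr mulmxDl.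
Qed.

End TimeSort.

(** * Assembly over the parity components of the word *)

Unset Implicit Arguments.

Local Opaque slice parity translation expm.

Theorem theorem4 (R : realType) (L N : nat) (eps : R)
    (H : 'M[R[i]]_(2 ^ L)) (k : nat)
    (O : 'I_k -> 'M[R[i]]_(2 ^ L)) (t : 'I_k -> 'I_N) :
  (1 <= L)%N -> (1 <= N)%N -> 0 < eps ->
  is_hermitian H -> parity_preserving H ->
  \tr (parity R (L * N) *m eiS N eps H *m \prod_(l < k) slice N (t l) (O l))
  = \tr (expm ((- ('i * (eps * N%:R)%:C)) *: H) *m
         Tord (fun l => eps * (t l)%:R) (fun l => heis H (eps * (t l)%:R) (O l))).
Proof.
move=> _ N_gt0 eps_gt0 _ H_par.
have H_even : parity_conj H = H by exact: comm_parity_conj.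
pose V := expm ((- ('i * eps%:C)) *: H); pose Vi := expm (('i * eps%:C) *: H).
have VVi : V *m Vi = 1%:M by rewrite /V scaleNr; exact: expmNK.
have ViV : Vi *m V = 1%:M by exact: mulmx1C.
have V_even : parity_conj V = V by apply: parity_conj_expm; rewrite parity_conjZ H_even.
have Vi_even : parity_conj Vi = Vi by apply: parity_conj_expm; rewrite parity_conjZ H_even.
have eiSE : eiS N eps H = translation L N eps *m slices_below N V N.
  rewrite /eiS /slices_below; congr (_ *m _); apply: eq_bigr => u _.
  by rewrite -sliceZ // -slice_expm.
have timesE (n : nat) : 'i * (eps * n%:R)%:C = n%:R * ('i * eps%:C) :> R[i].
  by rewrite rmorphM rmorph_nat; ring.
have ViX (n : nat) : expm (('i * (eps * n%:R)%:C) *: H) = Vi ^+ n.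
  by rewrite timesE -scalerA expm_natmul.
have VX (n : nat) : expm ((- ('i * (eps * n%:R)%:C)) *: H) = V ^+ n.
  by rewrite timesE -mulrN -scalerA expm_natmul.
have heisE (n : nat) A : heis H (eps * n%:R) A = heis_step V Vi n A.
  by rewrite /heis ViX VX.
(* A reordering sign exists only for definite parities, so the word is expanded exactly as [Tord]
   expands the right-hand side. *)
have split_parity (l : 'I_k) :
    slice N (t l) (O l) = \sum_(b : bool) slice N (t l) (par_part b (O l)).
  by rewrite {1}(even_add_odd (O l)) !big_bool sliceD.
have -> : \prod_(l < k) slice N (t l) (O l) =
    \sum_(c : {ffun 'I_k -> bool}) \prod_(l < k) slice N (t l) (par_part (c l) (O l)).
  rewrite (eq_bigr _ (fun l _ => split_parity l)); exact: bigA_distr_bigA.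
have tr_sum n (F : {ffun 'I_k -> bool} -> 'M[R[i]]_n) :
    \tr (\sum_c F c) = \sum_c \tr (F c) by exact: raddf_sum.
rewrite eiSE VX /Tord !mulmx_sumr !tr_sum; apply: eq_bigr => c _.
set s := fun l : 'I_k => eps * (t l)%:R.
have s_le (i j : 'I_k) : (s i <= s j) = (t i <= t j)%N by rewrite /s ler_pM2l // ler_nat.
(* The slice word is sorted before it is transported. The sign depends only on labels and parities,
   so it cancels against the one in [Tord]. *)
rewrite (@prod_tsort_sign _ _ _ s c) => [|p q spq]; last first.
  apply: slice_sign_comm => //; try exact: parity_conj_par_part.
  by apply: contraNneq spq => tpq; rewrite /s tpq.
rewrite /Tdef -!scalemxAr !mxtraceZ; congr (_ * _).
have srt : sorted (fun i j : 'I_k => (t j <= t i)%N) (tsort s).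
  rewrite (eq_sorted (e' := fun i j => s j <= s i)); first exact: tsort_sorted.
  by move=> i j; rewrite s_le.
rewrite (trace_time_ordered N_gt0 eps_gt0 VVi ViV V_even
           (fun l => par_part (c l) (O l)) _ srt) //.
congr (\tr (_ *m _)); apply: eq_bigr => l _.
by rewrite heisE heis_step_par_part.
Qed.
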